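(* Let $n\ge1$ and let $z(u)\in\mathrm{Y}(\mathfrak{q}_n)[[u^{-1}]]$ be the central series of the queer super-Yangian determined by $(\Lambda\otimes1)T^1(u)\tau_2(\widetilde T^2(u))=\Lambda\otimes z(u)$ (see context). Let $H_1(u),\dots,H_n(u)$ be the diagonal blocks in the block Gauss decomposition of $T(u)$ and $\widetilde H_a(u)=H_a(u)^{-1}$. Then $$z(u)=\prod_{a=1}^n\Big(1-\mathrm{str}\big(H_a(u)\,\partial\widetilde H_a(u)\big)\Big),$$ where $\partial\widetilde H_a(u)$ is the formal derivative of $\widetilde H_a(u)$ with respect to $u$.
   Context: Everything is over $\mathbb{C}$. Tensor products of superalgebras have product $(a_1\otimes b_1)(a_2\otimes b_2)=(-1)^{|a_2||b_1|}a_1a_2\otimes b_1b_2$. $I_{n|n}=\{-n,\dots,-1,1,\dots,n\}$, with $|i|=\bar0$ for $i>0$, $|i|=\bar1$ for $i<0$; $\mathsf{E}_{ij}\in\mathrm{End}(\mathbb{C}^{n|n})$ are matrix units of parity $|i|+|j|$. $\mathrm{Y}(\mathfrak{q}_n)$ is the unital associative superalgebra generated by $t_{ij}^{(r)}$ ($i,j\in I_{n|n}$, $r\ge1$) of parity $|i|+|j|$; with $t_{ij}(u)=\delta_{ij}+\sum_{r\ge1}t_{ij}^{(r)}u^{-r}$ and $T(u)=\sum\mathsf{E}_{ij}\otimes t_{ij}(u)$, the defining relations are $t_{ij}(-u)=t_{-i,-j}(u)$ and $R(u,v)T^1(u)T^2(v)=T^2(v)T^1(u)R(u,v)$, where $R(u,v)=1-\frac1{u-v}\sum_{i,j}(-1)^{|j|}\mathsf{E}_{ij}\otimes\mathsf{E}_{ji}-\frac1{u+v}\sum_{i,j}(-1)^{|j|}\mathsf{E}_{ij}\otimes\mathsf{E}_{-j,-i}$,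 and for $X=\sum\mathsf{E}_{ij}\otimes x_{ij}$, $X^1=\sum\mathsf{E}_{ij}\otimes1\otimes x_{ij}$, $X^2=\sum1\otimes\mathsf{E}_{ij}\otimes x_{ij}$. $\widetilde T(u)=T(u)^{-1}$. $\tau$ is the linear map on $\mathrm{End}(\mathbb{C}^{n|n})$ with $\tau(\mathsf{E}_{ij})=(-1)^{|i||j|+|i|}\mathsf{E}_{ji}$ and $\tau_2$ is its action on the second tensor factor; $\Lambda=\sum_{i,j\in I_{n|n}}(-1)^{|i||j|}\mathsf{E}_{ij}\otimes\mathsf{E}_{ij}$. It is known (Nazarov) that there is a unique series $z(u)\in 1+u^{-1}\mathrm{Y}(\mathfrak{q}_n)[[u^{-1}]]$ with $(\Lambda\otimes1)T^1(u)\tau_2(\widetilde T^2(u))=\Lambda\otimes z(u)$, and its coefficients are central. Block Gauss decomposition: let $\varepsilon_{ij}$ ($i,j\in\{1,-1\}$) be the matrix units of $\mathrm{End}(\mathbb{C}^{1|1})$, of parity $|i|+|j|$. View $T(u)$ as an $n\times n$ matrix with entries $T_{ab}(u)=\sum_{i,j=\pm1}\varepsilon_{ij}\otimes t_{ia,jb}(u)\in\mathrm{End}(\mathbb{C}^{1|1})\otimes\mathrm{Y}(\mathfrak{q}_n)[[u^{-1}]]$, $1\le a,b\le n$. There is a unique factorization $T(u)=F(u)H(u)E(u)$ with $F$ lower unitriangular, $H=\mathrm{diag}(H_1(u),\dots,H_n(u))$, $E$ upper unitriangular (as $n\times n$ matrices over $\mathrm{End}(\mathbb{C}^{1|1})\otimes\mathrm{Y}(\mathfrak{q}_n)[[u^{-1}]]$).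 Products and inverses of blocks are taken in $\mathrm{End}(\mathbb{C}^{1|1})\otimes\mathrm{Y}(\mathfrak{q}_n)[[u^{-1}]]$. For $A=\sum_{i,j=\pm1}\varepsilon_{ij}\otimes a_{ij}$, $\mathrm{str}(A)=a_{11}-a_{-1,-1}$. *)

(* Defs.v *)
From HB Require Import structures.
From mathcomp Require Import all_boot all_order all_algebra generic_quotient.
From mathcomp Require Import boolp functions reals.
From mathcomp Require Import complex.

Set Implicit Arguments.
Unset Strict Implicit.
Unset Printing Implicit Defensive.

Import GRing.Theory.
Local Open Scope ring_scope.

(* Parities are booleans, true being odd.  The K-algebra structure is given *)
(* by the central unit map c |-> c 1 (the library's algType excludes the zero *)
(* algebra), and the Z/2-grading by its homogeneous projections: [hpart b x] *)
(* is the component of parity b of x. *)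
HB.mixin Record isSuperAlgebra (K : fieldType) A of GRing.PzRing A := {
  kunit : K -> A;
  kunitD : {morph kunit : c d / c + d};
  kunitM : {morph kunit : c d / c * d};
  kunit1 : kunit 1 = 1;
  kunitC : forall (c : K) (x : A), kunit c * x = x * kunit c;
  hpart : bool -> A -> A;
  hpartD : forall b, {morph hpart b : x y / x + y};
  hpart_sum : forall x : A, hpart false x + hpart true x = x;
  hpart_proj : forall b c (x : A),
    hpart b (hpart c x) = if b == c then hpart b x else 0;
  hpart_kunit : forall c : K, hpart false (kunit c) = kunit c;
  hpart_mul : forall b c (x y : A),
    hpart (b (+) c) (hpart b x * hpart c y) = hpart b x * hpart c y
}.

#[short(type="superAlgType")]
HB.structure Definition SuperAlgebra (K : fieldType) :=
  {A of GRing.PzRing A & isSuperAlgebra K A}.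

Section SuperTheory.
Variables (K : fieldType) (A : superAlgType K).
Implicit Types x y : A.

Lemma kunit0 : kunit 0 = 0 :> A.
Proof. by apply: (addrI (kunit 0)); rewrite -kunitD !addr0. Qed.

Lemma hpart0 b : hpart b (0 : A) = 0.
Proof. by apply: (addrI (hpart b 0)); rewrite -hpartD !addr0. Qed.

Lemma hpartN b x : hpart b (- x) = - hpart b x.
Proof. by apply: (addrI (hpart b x)); rewrite -hpartD !subrr hpart0. Qed.

Lemma hpart_one : hpart false (1 : A) = 1.
Proof. by rewrite -kunit1 hpart_kunit. Qed.

Lemma hpart_big b (I : Type) (r : seq I) (P : pred I) (F : I -> A) :
  hpart b (\sum_(i <- r | P i) F i) = \sum_(i <- r | P i) hpart b (F i).
Proof. by apply: (big_morph _ (hpartD b) (hpart0 b)). Qed.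

Lemma hpart_sign b (c : bool) x : hpart b ((-1) ^+ c * x) = (-1) ^+ c * hpart b x.
Proof. by rewrite !mulr_sign; case: c; rewrite ?hpartN. Qed.

(* The Koszul sign of moving x past an element of parity b. *)
Definition ksign (b : bool) x : A := hpart false x + (-1) ^+ b * hpart true x.

Lemma ksignD b x y : ksign b (x + y) = ksign b x + ksign b y.
Proof. by rewrite /ksign !hpartD mulrDr addrACA. Qed.

Lemma ksign0 b : ksign b 0 = 0.
Proof. by rewrite /ksign !hpart0 mulr0 addr0. Qed.

Lemma ksign_big b (I : Type) (r : seq I) (P : pred I) (F : I -> A) :
  ksign b (\sum_(i <- r | P i) F i) = \sum_(i <- r | P i) ksign b (F i).
Proof. by apply: (big_morph _ (ksignD b) (ksign0 b)). Qed.

Lemma ksign_id x : ksign false x = x.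
Proof. by rewrite /ksign mul1r hpart_sum. Qed.

Lemma ksign_hpart b c x : ksign b (hpart c x) = (-1) ^+ (b && c) * hpart c x.
Proof.
rewrite /ksign !hpart_proj; case: c; rewrite /= ?add0r ?mulr0 ?addr0.
  by rewrite andbT.
by rewrite andbF mul1r.
Qed.

Lemma hpart_ksign b c x : hpart b (ksign c x) = ksign c (hpart b x).
Proof.
rewrite ksign_hpart /ksign hpartD hpart_sign !hpart_proj.
by case: b; case: c; rewrite /= ?mul1r ?mulr0 ?addr0 ?add0r.
Qed.

Lemma ksignK b c x : ksign b (ksign c x) = ksign (b (+) c) x.
Proof.
rewrite {2}/ksign ksignD ksign_hpart andbF mul1r /ksign !hpart_sign.
by rewrite !hpart_proj /= mulr0 add0r mulrA -signr_addb.
Qed.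

Lemma ksign_kunit b c : ksign b (kunit c) = kunit c :> A.
Proof. by rewrite -hpart_kunit ksign_hpart andbF mul1r. Qed.

Lemma ksign_one b : ksign b 1 = 1 :> A.
Proof. by rewrite -kunit1 ksign_kunit. Qed.

Lemma ksign_mul b x y : ksign b (x * y) = ksign b x * ksign b y.
Proof.
have E c d : ksign b (hpart c x * hpart d y)
    = ksign b (hpart c x) * ksign b (hpart d y).
  rewrite -hpart_mul !ksign_hpart hpart_mul !mulr_sign.
  by case: b; case: c; case: d; rewrite /= ?mulrN ?mulNr ?opprK.
rewrite -[x]hpart_sum -[y]hpart_sum [in RHS]ksignD [in RHS]ksignD.
rewrite (mulrDl (hpart false x)) !(mulrDr (hpart _ x)) !ksignD !E.
by rewrite (mulrDl (ksign b (hpart false x))) !(mulrDr (ksign b (hpart _ x))).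
Qed.

End SuperTheory.

(* f : fps A stands for \sum_r (f r) u^-r. *)
Definition fps (A : Type) : Type := nat -> A.

Section FpsZmod.
Variable A : zmodType.
HB.instance Definition _ := GRing.Zmodule.copy (fps A) (nat -> A).
Lemma fpsDE (f g : fps A) r : (f + g) r = f r + g r. Proof. by []. Qed.
Lemma fpsNE (f : fps A) r : (- f) r = - f r. Proof. by []. Qed.
Lemma fps0E r : (0 : fps A) r = 0. Proof. by []. Qed.
Lemma fps_sumE (I : Type) (s : seq I) (P : pred I) (F : I -> fps A) r :
  (\sum_(i <- s | P i) F i) r = \sum_(i <- s | P i) F i r.
Proof. by apply: (big_morph (fun f : fps A => f r)). Qed.
End FpsZmod.

Section FpsRing.
Variable A : pzRingType.
Implicit Types f g h : fps A.

Definition fps_one : fps A := fun r => if r is 0 then 1 else 0.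
Definition fps_mul f g : fps A := fun r => \sum_(i < r.+1) f i * g (r - i)%N.

Lemma fps_mul_rev f g r : fps_mul f g r = \sum_(i < r.+1) f (r - i)%N * g i.
Proof.
rewrite /fps_mul (reindex_inj rev_ord_inj) /=.
by apply: eq_bigr => i _; rewrite (sub_ordK i).
Qed.

Fact fps_mulA : associative fps_mul.
Proof.
move=> f g h; apply: funext => r; rewrite {1}/fps_mul fps_mul_rev.
pose c3 j k := f j * (g (r - j - k)%N * h k).
transitivity (\sum_(j < r.+1) \sum_(k < r.+1 | (k <= r - j)%N) c3 j k).
  apply: eq_bigr => /= j _; rewrite fps_mul_rev big_distrr /=.
  by rewrite (big_ord_narrow_leq (leq_subr _ _)).
rewrite (exchange_big_dep predT) //=; apply: eq_bigr => k _.
transitivity (\sum_(j < r.+1 | (j <= r - k)%N) c3 j k).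
  apply: eq_bigl => j; rewrite -ltnS -(ltnS j) -!subSn ?leq_ord //.
  by rewrite -subn_gt0 -(subn_gt0 j) -!subnDA addnC.
rewrite (big_ord_narrow_leq (leq_subr _ _)) /fps_mul big_distrl /=.
by apply: eq_bigr => j _; rewrite /c3 -!subnDA addnC mulrA.
Qed.

Fact fps_mul1r : left_id fps_one fps_mul.
Proof.
move=> f; apply: funext => r; rewrite /fps_mul big_ord_recl subn0 mul1r.
by rewrite big1 ?addr0 // => i _; rewrite mul0r.
Qed.

Fact fps_mulr1 : right_id fps_one fps_mul.
Proof.
move=> f; apply: funext => r; rewrite fps_mul_rev big_ord_recl subn0 mulr1.
by rewrite big1 ?addr0 // => i _; rewrite mulr0.
Qed.

Fact fps_mulDl : left_distributive fps_mul +%R.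
Proof.
move=> f g h; apply: funext => r; rewrite fpsDE /fps_mul -big_split /=.
by apply: eq_bigr => i _; rewrite mulrDl.
Qed.

Fact fps_mulDr : right_distributive fps_mul +%R.
Proof.
move=> f g h; apply: funext => r; rewrite fpsDE /fps_mul -big_split /=.
by apply: eq_bigr => i _; rewrite mulrDr.
Qed.

HB.instance Definition _ := GRing.Zmodule_isPzRing.Build (fps A)
  fps_mulA fps_mul1r fps_mulr1 fps_mulDl fps_mulDr.

Lemma fps1E r : (1 : fps A) r = if r is 0 then 1 else 0. Proof. by []. Qed.
Lemma fpsME f g r : (f * g) r = \sum_(i < r.+1) f i * g (r - i)%N.
Proof. by []. Qed.

End FpsRing.

Section FpsSuper.
Variables (K : fieldType) (A : superAlgType K).
Implicit Types f g : fps A.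

Definition fps_const (a : A) : fps A := fun r => if r is 0 then a else 0.

Definition fps_hpart b f : fps A := fun r => hpart b (f r).

Definition fps_kunit (c : K) : fps A := fps_const (kunit c).

Fact fps_kunitD : {morph fps_kunit : c d / c + d}.
Proof. by move=> c d; apply: funext => -[|r]; rewrite fpsDE /= ?kunitD ?addr0. Qed.

Lemma fps_constME (a : A) f r : (fps_const a * f) r = a * f r.
Proof.
rewrite fpsME big_ord_recl subn0 big1 ?addr0 // => i _.
by rewrite mul0r.
Qed.

Lemma fpsMconstE (a : A) f r : (f * fps_const a) r = f r * a.
Proof.
rewrite fpsME big_ord_recr /= subnn big1 ?add0r // => i _.
have := subn_gt0 i r; rewrite (ltn_ord i) /=.
by case: (r - i)%N => // k _; rewrite mulr0.
Qed.

Fact fps_kunitM : {morph fps_kunit : c d / c * d}.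
Proof.
by move=> c d; apply: funext => -[|r]; rewrite fps_constME /= ?kunitM ?mulr0.
Qed.

Fact fps_kunit1 : fps_kunit 1 = 1.
Proof. by apply: funext => -[|r] //; rewrite /fps_kunit /= kunit1. Qed.

Fact fps_kunitC (c : K) f : fps_kunit c * f = f * fps_kunit c.
Proof. by apply: funext => r; rewrite fps_constME fpsMconstE kunitC. Qed.

Fact fps_hpartD b : {morph fps_hpart b : f g / f + g}.
Proof. by move=> f g; apply: funext => r; apply: hpartD. Qed.

Fact fps_hpart_sum f : fps_hpart false f + fps_hpart true f = f.
Proof. by apply: funext => r; apply: hpart_sum. Qed.

Fact fps_hpart_proj b c f :
  fps_hpart b (fps_hpart c f) = if b == c then fps_hpart b f else 0.
Proof. by apply: funext => r; rewrite /fps_hpart hpart_proj; case: ifP. Qed.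

Fact fps_hpart_kunit (c : K) : fps_hpart false (fps_kunit c) = fps_kunit c.
Proof.
by apply: funext => -[|r]; rewrite /fps_hpart /= ?hpart_kunit ?hpart0.
Qed.

Fact fps_hpart_mul b c f g :
  fps_hpart (b (+) c) (fps_hpart b f * fps_hpart c g)
    = fps_hpart b f * fps_hpart c g.
Proof.
apply: funext => r; rewrite /fps_hpart !fpsME hpart_big.
by apply: eq_bigr => i _; rewrite hpart_mul.
Qed.

HB.instance Definition _ := isSuperAlgebra.Build K (fps A)
  fps_kunitD fps_kunitM fps_kunit1 fps_kunitC fps_hpartD fps_hpart_sum
  fps_hpart_proj fps_hpart_kunit fps_hpart_mul.

(* the series u^-1 *)
Definition fps_uinv : fps A := fun r => if r is 1 then 1 else 0.

(* f(-u) *)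
Definition fps_neg f : fps A := fun r => (-1) ^+ r * f r.

(* d/du, so that u^-r is sent to - r u^-(r+1) *)
Definition fps_deriv f : fps A :=
  fun r => if r is r'.+1 then - (f r' *+ r') else 0.

End FpsSuper.

(* Elements of A[[u^-1, v^-1]] have type fps (fps A), where the outer *)
(* variable is u^-1 and the inner one is v^-1. *)
Definition in_u (K : fieldType) (A : superAlgType K) (f : fps A) : fps (fps A) :=
  fun r => fps_const (f r).
Definition in_v (K : fieldType) (A : superAlgType K) (f : fps A) : fps (fps A) :=
  fps_const f.

(* X : smx p A stands for \sum_(i, j) E_ij (x) X (i, j), where the basis *)
(* vector of index i has parity p i. *)
Definition smx (I : finType) (p : I -> bool) (A : Type) : Type :=
  {ffun I * I -> A}.

Section SmxZmod.
Variables (I : finType) (p : I -> bool) (A : zmodType).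
HB.instance Definition _ := GRing.Zmodule.copy (smx p A) {ffun I * I -> A}.
End SmxZmod.

Section SmxSuper.
Variables (K : fieldType) (I : finType) (p : I -> bool) (A : superAlgType K).
Implicit Types X Y Z : smx p A.

Definition smx_one : smx p A := [ffun ij => if ij.1 == ij.2 then 1 else 0].

(* (E_ij (x) a) (E_jk (x) b) = (-1)^(|a| (|j| + |k|)) E_ik (x) a b *)
Definition smx_mul X Y : smx p A :=
  [ffun ik => \sum_j ksign (p j (+) p ik.2) (X (ik.1, j)) * Y (j, ik.2)].

Definition smx_hpart b X : smx p A :=
  [ffun ij => hpart (b (+) p ij.1 (+) p ij.2) (X ij)].

Fact smx_mulA : associative smx_mul.
Proof.
move=> X Y Z; apply/ffunP => -[i l]; rewrite !ffunE /=.
under eq_bigr => j _ do rewrite ffunE /= big_distrr /=.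
under [in RHS]eq_bigr => k _ do rewrite ffunE /= ksign_big big_distrl /=.
rewrite exchange_big; apply: eq_bigr => k _; apply: eq_bigr => j _.
rewrite ksign_mul ksignK mulrA; congr (ksign _ _ * _ * _).
by case: (p j); case: (p k); case: (p l).
Qed.

Fact smx_mul1r : left_id smx_one smx_mul.
Proof.
move=> X; apply/ffunP => -[i l]; rewrite !ffunE /= (bigD1 i) //=.
rewrite ffunE /= eqxx ksign_one mul1r big1 ?addr0 // => j ji.
by rewrite ffunE /= eq_sym (negPf ji) ksign0 mul0r.
Qed.

Fact smx_mulr1 : right_id smx_one smx_mul.
Proof.
move=> X; apply/ffunP => -[i l]; rewrite !ffunE /= (bigD1 l) //=.
rewrite ffunE /= eqxx addbb ksign_id mulr1 big1 ?addr0 // => j ji.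
by rewrite ffunE /= (negPf ji) mulr0.
Qed.

Fact smx_mulDl : left_distributive smx_mul +%R.
Proof.
move=> X Y Z; apply/ffunP => -[i l]; rewrite !ffunE /= -big_split /=.
by apply: eq_bigr => j _; rewrite ffunE ksignD mulrDl.
Qed.

Fact smx_mulDr : right_distributive smx_mul +%R.
Proof.
move=> X Y Z; apply/ffunP => -[i l]; rewrite !ffunE /= -big_split /=.
by apply: eq_bigr => j _; rewrite ffunE mulrDr.
Qed.

HB.instance Definition _ := GRing.Zmodule_isPzRing.Build (smx p A)
  smx_mulA smx_mul1r smx_mulr1 smx_mulDl smx_mulDr.

Lemma smxDE X Y ij : (X + Y) ij = X ij + Y ij. Proof. exact: ffunE. Qed.
Lemma smxNE X ij : (- X) ij = - X ij. Proof. exact: ffunE. Qed.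
Lemma smx0E ij : (0 : smx p A) ij = 0. Proof. exact: ffunE. Qed.
Lemma smx1E i j : (1 : smx p A) (i, j) = if i == j then 1 else 0.
Proof. exact: ffunE. Qed.
Lemma smxME X Y i k :
  (X * Y) (i, k) = \sum_j ksign (p j (+) p k) (X (i, j)) * Y (j, k).
Proof. exact: ffunE. Qed.
Lemma smx_sumE (J : Type) (s : seq J) (P : pred J) (F : J -> smx p A) ij :
  (\sum_(k <- s | P k) F k) ij = \sum_(k <- s | P k) F k ij.
Proof. exact: sum_ffunE. Qed.

(* E_ij (x) a *)
Definition smx_unit (i j : I) (a : A) : smx p A :=
  [ffun kl => if kl == (i, j) then a else 0].

(* 1 (x) a *)
Definition smx_scal (a : A) : smx p A := \sum_i smx_unit i i a.

Lemma smx_scalE (a : A) i j : smx_scal a (i, j) = if i == j then a else 0.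
Proof.
rewrite smx_sumE (bigD1 i) //= ffunE xpair_eqE eqxx eq_sym big1 ?addr0 // => k ki.
by rewrite ffunE xpair_eqE eq_sym (negPf ki).
Qed.

Definition smx_kunit (c : K) : smx p A := smx_scal (kunit c).

Fact smx_kunitD : {morph smx_kunit : c d / c + d}.
Proof.
move=> c d; apply/ffunP => -[i j]; rewrite smxDE !smx_scalE kunitD.
by case: ifP; rewrite ?addr0.
Qed.

Fact smx_kunitME (c : K) X ij : (smx_kunit c * X) ij = kunit c * X ij.
Proof.
case: ij => i k; rewrite smxME (bigD1 i) //= smx_scalE eqxx ksign_kunit.
by rewrite big1 ?addr0 // => j ji; rewrite smx_scalE eq_sym (negPf ji) ksign0 mul0r.
Qed.

Fact smx_kunitM : {morph smx_kunit : c d / c * d}.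
Proof.
move=> c d; apply/ffunP => -[i j]; rewrite smx_kunitME !smx_scalE kunitM.
by case: ifP; rewrite ?mulr0.
Qed.

Fact smx_kunit1 : smx_kunit 1 = 1.
Proof. by apply/ffunP => -[i j]; rewrite smx_scalE smx1E kunit1. Qed.

Fact smx_kunitC (c : K) X : smx_kunit c * X = X * smx_kunit c.
Proof.
apply/ffunP => -[i k]; rewrite smx_kunitME smxME (bigD1 k) //= smx_scalE eqxx.
rewrite addbb ksign_id kunitC big1 ?addr0 // => j jk.
by rewrite smx_scalE (negPf jk) mulr0.
Qed.

Fact smx_hpartD b : {morph smx_hpart b : X Y / X + Y}.
Proof. by move=> X Y; apply/ffunP => ij; rewrite !ffunE hpartD. Qed.

Fact smx_hpart_sum X : smx_hpart false X + smx_hpart true X = X.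
Proof.
apply/ffunP => ij; rewrite smxDE !ffunE -[RHS]hpart_sum.
by case: (p _); case: (p _); rewrite /= // addrC.
Qed.

Fact smx_hpart_proj b c X :
  smx_hpart b (smx_hpart c X) = if b == c then smx_hpart b X else 0.
Proof.
apply/ffunP => ij; rewrite !ffunE hpart_proj.
by case: b; case: c; rewrite /= !ffunE //; case: (p _); case: (p _).
Qed.

Fact smx_hpart_kunit (c : K) : smx_hpart false (smx_kunit c) = smx_kunit c.
Proof.
apply/ffunP => -[i j]; rewrite ffunE smx_scalE /=.
by case: eqP => [->|_]; rewrite ?addbb ?hpart_kunit ?hpart0.
Qed.

Fact smx_hpart_mul b c X Y :
  smx_hpart (b (+) c) (smx_hpart b X * smx_hpart c Y)
    = smx_hpart b X * smx_hpart c Y.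
Proof.
apply/ffunP => -[i k]; rewrite ffunE !smxME hpart_big.
apply: eq_bigr => j _; rewrite !ffunE /= -hpart_ksign.
rewrite -[RHS]hpart_mul; congr (hpart _ _).
by case: b; case: c; case: (p i); case: (p j); case: (p k).
Qed.

HB.instance Definition _ := isSuperAlgebra.Build K (smx p A)
  smx_kunitD smx_kunitM smx_kunit1 smx_kunitC smx_hpartD smx_hpart_sum
  smx_hpart_proj smx_hpart_kunit smx_hpart_mul.

End SmxSuper.
Arguments smx_unit {K I} p {A}.
Arguments smx_scal {K I} p {A}.

Section Presented.
Variables (K : fieldType) (G : Type).

Inductive sterm : Type :=
| tgen of G
| tconst of K
| tadd of sterm & sterm
| topp of sterm
| tmul of sterm & sterm
| thpart of bool & sterm.

HB.instance Definition _ := gen_eqMixin sterm.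
HB.instance Definition _ := gen_choiceMixin sterm.

Fixpoint teval (A : superAlgType K) (a : G -> A) (s : sterm) : A :=
  match s with
  | tgen g => a g
  | tconst c => kunit c
  | tadd s1 s2 => teval a s1 + teval a s2
  | topp s1 => - teval a s1
  | tmul s1 s2 => teval a s1 * teval a s2
  | thpart b s1 => hpart b (teval a s1)
  end.

Variable rels : forall A : superAlgType K, (G -> A) -> Prop.

(* Two terms are identified when their equality is a consequence of the *)
(* relations, i.e. when it holds in every superalgebra satisfying them. *)
Definition tequiv (s t : sterm) : bool :=
  `[< forall (A : superAlgType K) (a : G -> A),
        rels a -> teval a s = teval a t >].

Fact tequiv_refl : reflexive tequiv.
Proof. by move=> s; apply/asboolP. Qed.

Fact tequiv_sym : symmetric tequiv.
Proof. by move=> s t; apply/asboolP/asboolP => E A a /E. Qed.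

Fact tequiv_trans : transitive tequiv.
Proof.
by move=> t s r /asboolP E /asboolP F; apply/asboolP => A a H; rewrite E ?F.
Qed.

Canonical tequiv_rel := EquivRel tequiv tequiv_refl tequiv_sym tequiv_trans.

Local Open Scope quotient_scope.

Definition presented : Type := {eq_quot tequiv_rel}.
HB.instance Definition _ := Choice.on presented.
HB.instance Definition _ := EqQuotient.on presented.

Implicit Types x y z : presented.

Lemma presentedP (s t : sterm) :
  \pi_presented s = \pi_presented t <->
  (forall (A : superAlgType K) (a : G -> A),
    rels a -> teval a s = teval a t).
Proof. by split=> [/eqmodP/asboolP|/asboolP H]; last exact/eqmodP. Qed.

(* The homomorphism to A extending a. *)
Definition pext (A : superAlgType K) (a : G -> A) x : A := teval a (repr x).

Lemma pext_pi (A : superAlgType K) (a : G -> A) s :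
  rels a -> pext a (\pi_presented s) = teval a s.
Proof.
by move=> Ha; move: A a Ha; apply/presentedP; rewrite reprK.
Qed.

Lemma pext_inj x y : (forall (A : superAlgType K) (a : G -> A),
  rels a -> pext a x = pext a y) -> x = y.
Proof. by move=> E; rewrite -[x]reprK -[y]reprK; apply/presentedP. Qed.

Definition pgen (g : G) : presented := \pi_presented (tgen g).
Definition pconst (c : K) : presented := \pi_presented (tconst c).
Definition padd x y : presented := \pi_presented (tadd (repr x) (repr y)).
Definition popp x : presented := \pi_presented (topp (repr x)).
Definition pmul x y : presented := \pi_presented (tmul (repr x) (repr y)).
Definition phpart b x : presented := \pi_presented (thpart b (repr x)).

Section Eval.
Variables (A : superAlgType K) (a : G -> A) (Ha : rels a).
Lemma pext_gen g : pext a (pgen g) = a g.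
Proof. exact: pext_pi. Qed.
Lemma pext_const c : pext a (pconst c) = kunit c.
Proof. exact: pext_pi. Qed.
Lemma pext_add x y : pext a (padd x y) = pext a x + pext a y.
Proof. exact: pext_pi. Qed.
Lemma pext_opp x : pext a (popp x) = - pext a x.
Proof. exact: pext_pi. Qed.
Lemma pext_mul x y : pext a (pmul x y) = pext a x * pext a y.
Proof. exact: pext_pi. Qed.
Lemma pext_hpart b x : pext a (phpart b x) = hpart b (pext a x).
Proof. exact: pext_pi. Qed.
End Eval.
Let pextE := (pext_gen, pext_const, pext_add, pext_opp, pext_mul, pext_hpart).

Fact paddA : associative padd.
Proof. by move=> x y z; apply: pext_inj => A a H; rewrite !pextE // addrA. Qed.
Fact paddC : commutative padd.
Proof. by move=> x y; apply: pext_inj => A a H; rewrite !pextE // addrC. Qed.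
Fact padd0 : left_id (pconst 0) padd.
Proof.
by move=> x; apply: pext_inj => A a H; rewrite !pextE // kunit0 add0r.
Qed.
Fact paddN : left_inverse (pconst 0) popp padd.
Proof.
by move=> x; apply: pext_inj => A a H; rewrite !pextE // kunit0 addNr.
Qed.
Fact pmulA : associative pmul.
Proof. by move=> x y z; apply: pext_inj => A a H; rewrite !pextE // mulrA. Qed.
Fact pmul1r : left_id (pconst 1) pmul.
Proof.
by move=> x; apply: pext_inj => A a H; rewrite !pextE // kunit1 mul1r.
Qed.
Fact pmulr1 : right_id (pconst 1) pmul.
Proof.
by move=> x; apply: pext_inj => A a H; rewrite !pextE // kunit1 mulr1.
Qed.
Fact pmulDl : left_distributive pmul padd.
Proof. by move=> x y z; apply: pext_inj => A a H; rewrite !pextE // mulrDl. Qed.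
Fact pmulDr : right_distributive pmul padd.
Proof. by move=> x y z; apply: pext_inj => A a H; rewrite !pextE // mulrDr. Qed.

HB.instance Definition _ := GRing.isZmodule.Build presented
  paddA paddC padd0 paddN.
HB.instance Definition _ := GRing.Zmodule_isPzRing.Build presented
  pmulA pmul1r pmulr1 pmulDl pmulDr.

Fact pconstD : {morph pconst : c d / c + d}.
Proof. by move=> c d; apply: pext_inj => A a H; rewrite !pextE // kunitD. Qed.
Fact pconstM : {morph pconst : c d / c * d}.
Proof. by move=> c d; apply: pext_inj => A a H; rewrite !pextE // kunitM. Qed.
Fact pconstC (c : K) x : pconst c * x = x * pconst c.
Proof. by apply: pext_inj => A a H; rewrite !pextE // kunitC. Qed.
Fact phpartD b : {morph phpart b : x y / x + y}.
Proof. by move=> x y; apply: pext_inj => A a H; rewrite !pextE // hpartD. Qed.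
Fact phpart_sum x : phpart false x + phpart true x = x.
Proof. by apply: pext_inj => A a H; rewrite !pextE // hpart_sum. Qed.
Fact phpart_proj b c x :
  phpart b (phpart c x) = if b == c then phpart b x else 0.
Proof.
apply: pext_inj => A a H; rewrite !pextE // hpart_proj.
by case: ifP; rewrite !pextE // kunit0.
Qed.
Fact phpart_const (c : K) : phpart false (pconst c) = pconst c.
Proof. by apply: pext_inj => A a H; rewrite !pextE // hpart_kunit. Qed.
Fact phpart_mul b c x y :
  phpart (b (+) c) (phpart b x * phpart c y) = phpart b x * phpart c y.
Proof. by apply: pext_inj => A a H; rewrite !pextE // hpart_mul. Qed.

HB.instance Definition _ := isSuperAlgebra.Build K presented
  pconstD pconstM erefl pconstC phpartD phpart_sum phpart_proj phpart_const
  phpart_mul.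

End Presented.

(* The index set I_(n|n): (false, a) stands for a + 1 and (true, a) for *)
(* - (a + 1). *)
Definition qidx (n : nat) : finType := (bool * 'I_n)%type.
Definition qpar n (i : qidx n) : bool := i.1.
Definition qneg n (i : qidx n) : qidx n := (~~ i.1, i.2).

Notation QEnd n A := (smx (@qpar n) A).

Section TwoFactors.
Variables (K : fieldType) (n : nat) (S : superAlgType K).
Local Notation p := (@qpar n).

(* X^1 and X^2, in End(C^(n|n)) (x) End(C^(n|n)) (x) S *)
Definition tens1 (X : QEnd n S) : QEnd n (QEnd n S) :=
  \sum_i \sum_j smx_unit p i j (smx_scal p (X (i, j))).
Definition tens2 (X : QEnd n S) : QEnd n (QEnd n S) :=
  \sum_i \sum_j smx_scal p (smx_unit p i j (X (i, j))).

(* (\sum_(i, j) (-1)^|j| E_ij (x) E_ji) (x) s *)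
Definition Pmx (s : S) : QEnd n (QEnd n S) :=
  \sum_i \sum_j smx_unit p i j (smx_unit p j i ((-1) ^+ p j * s)).

(* (\sum_(i, j) (-1)^|j| E_ij (x) E_(-j,-i)) (x) s *)
Definition Qmx (s : S) : QEnd n (QEnd n S) :=
  \sum_i \sum_j smx_unit p i j (smx_unit p (qneg j) (qneg i) ((-1) ^+ p j * s)).

(* Lambda (x) s *)
Definition Lambda (s : S) : QEnd n (QEnd n S) :=
  \sum_i \sum_j smx_unit p i j (smx_unit p i j ((-1) ^+ (p i && p j) * s)).

Definition tau (X : QEnd n S) : QEnd n S :=
  \sum_i \sum_j smx_unit p j i ((-1) ^+ ((p i && p j) (+) p i) * X (i, j)).

(* tau is even, hence tau acts on the second factor without signs. *)
Definition tau2 (X : QEnd n (QEnd n S)) : QEnd n (QEnd n S) :=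
  [ffun ij => tau (X ij)].

End TwoFactors.

(* The generator (i, j, r) is t_ij^(r+1). *)
Definition qgen (n : nat) : Type := (qidx n * qidx n * nat)%type.
Definition qgen_par n (g : qgen n) : bool := qpar g.1.1 (+) qpar g.1.2.

Section Relations.
Variables (K : fieldType) (n : nat) (A : superAlgType K) (t : qgen n -> A).

Definition tser (i j : qidx n) : fps A :=
  fun r => if r is r'.+1 then t (i, j, r') else if i == j then 1 else 0.

Definition Tser : QEnd n (fps A) := [ffun ij => tser ij.1 ij.2].

Definition Tser_u : QEnd n (fps (fps A)) := [ffun ij => in_u (Tser ij)].
Definition Tser_v : QEnd n (fps (fps A)) := [ffun ij => in_v (Tser ij)].

(* R(u, v) multiplied by u^-2 v^-2 (u^2 - v^2) = v^-2 - u^-2, which is *)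
(* central and not a zero divisor: with x = u^-1 and y = v^-1 one has *)
(* 1 / (u - v) = x y (x + y) / (y^2 - x^2) and *)
(* 1 / (u + v) = x y (y - x) / (y^2 - x^2). *)
Definition Rser : QEnd n (QEnd n (fps (fps A))) :=
  let x : fps (fps A) := in_u (fps_uinv A) in
  let y : fps (fps A) := in_v (fps_uinv A) in
  smx_scal _ (smx_scal _ (y ^+ 2 - x ^+ 2))
  - Pmx n (x * y * (x + y)) - Qmx n (x * y * (y - x)).

Definition queer_relations : Prop :=
  [/\ forall g, hpart (qgen_par g) (t g) = t g,
      forall i j, fps_neg (tser i j) = tser (qneg i) (qneg j) &
      Rser * tens1 Tser_u * tens2 Tser_v = tens2 Tser_v * tens1 Tser_u * Rser].

End Relations.

Definition yangian (K : fieldType) (n : nat) : Type :=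
  presented (@queer_relations K n).
HB.instance Definition _ K n := SuperAlgebra.on (yangian K n).

Definition ygen (K : fieldType) (n : nat) (g : qgen n) : yangian K n :=
  pgen (@queer_relations K n) g.

(* End(C^(1|1)) (x) A, with true standing for the odd index -1 *)
Definition par11 (b : bool) : bool := b.
Notation End11 A := (smx par11 A).

Section Blocks.
Variables (K : fieldType) (n : nat) (A : superAlgType K).

Definition Tblocks (t : qgen n -> A) : 'M[End11 (fps A)]_n :=
  \matrix_(a, b) [ffun ij => tser t (ij.1, a) (ij.2, b)].

Definition lower_unitri (F : 'M[End11 (fps A)]_n) : Prop :=
  forall a b : 'I_n, (a <= b)%N -> F a b = if a == b then 1 else 0.

Definition upper_unitri (E : 'M[End11 (fps A)]_n) : Prop :=
  forall a b : 'I_n, (b <= a)%N -> E a b = if a == b then 1 else 0.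

Definition smx_deriv (X : End11 (fps A)) : End11 (fps A) :=
  [ffun ij => fps_deriv (X ij)].

Definition str (X : End11 (fps A)) : fps A :=
  X (false, false) - X (true, true).

End Blocks.

Section Morphisms.
Variable K : fieldType.

Record shom (A B : superAlgType K) (f : A -> B) : Prop := Shom {
  shomD : {morph f : x y / x + y};
  shomM : {morph f : x y / x * y};
  shom_kunit : forall c, f (kunit c) = kunit c;
  shom_hpart : forall b x, f (hpart b x) = hpart b (f x)
}.

Section ShomTheory.
Variables (A B : superAlgType K) (f : A -> B) (hf : shom f).

Lemma shom0 : f 0 = 0.
Proof. by apply: (addrI (f 0)); rewrite -(shomD hf) !addr0. Qed.

Lemma shom1 : f 1 = 1.
Proof. by rewrite -[1 in LHS]kunit1 (shom_kunit hf) kunit1. Qed.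

Lemma shomN x : f (- x) = - f x.
Proof. by apply: (addrI (f x)); rewrite -(shomD hf) !subrr shom0. Qed.

Lemma shomB x y : f (x - y) = f x - f y.
Proof. by rewrite (shomD hf) shomN. Qed.

Lemma shomX x m : f (x ^+ m) = f x ^+ m.
Proof. by elim: m => [|m IH]; rewrite ?shom1 // !exprS (shomM hf) IH. Qed.

Lemma shom_sign m x : f ((-1) ^+ m * x) = (-1) ^+ m * f x.
Proof. by rewrite (shomM hf) shomX shomN shom1. Qed.

Lemma shom_sum (I : Type) (r : seq I) (P : pred I) (F : I -> A) :
  f (\sum_(i <- r | P i) F i) = \sum_(i <- r | P i) f (F i).
Proof. by apply: (big_morph _ (shomD hf) shom0). Qed.

Lemma shom_ksign b x : f (ksign b x) = ksign b (f x).
Proof. by rewrite /ksign (shomD hf) shom_sign !(shom_hpart hf). Qed.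

End ShomTheory.

Definition map_fps (A B : Type) (f : A -> B) (g : fps A) : fps B :=
  fun r => f (g r).
Definition map_smx (I : finType) (p : I -> bool) (A B : Type) (f : A -> B)
  (X : smx p A) : smx p B := [ffun ij => f (X ij)].

Section Maps.
Variables (A B : superAlgType K) (f : A -> B) (hf : shom f).
Variables (n : nat).
Local Notation p := (@qpar n).

Lemma map_fps_const a : map_fps f (fps_const a) = fps_const (f a).
Proof. by apply: funext => -[|r]; rewrite // /map_fps /= shom0. Qed.

Lemma map_fps_uinv : map_fps f (fps_uinv A) = fps_uinv B.
Proof. by apply: funext => -[|[|r]]; rewrite /map_fps /= ?shom0 ?shom1. Qed.

Lemma map_fps_shom : shom (map_fps f).
Proof.
split=> [g h|g h|c|b g].
- by apply: funext => r; apply: (shomD hf).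
- apply: funext => r; rewrite /map_fps !fpsME shom_sum //.
  by apply: eq_bigr => i _; rewrite (shomM hf).
- by rewrite map_fps_const (shom_kunit hf).
- by apply: funext => r; apply: (shom_hpart hf).
Qed.

Lemma map_smx_unit i j a : map_smx f (smx_unit p i j a) = smx_unit p i j (f a).
Proof. by apply/ffunP => kl; rewrite !ffunE; case: ifP => // _; apply: shom0. Qed.

Lemma map_smx_scal a : map_smx f (smx_scal p a) = smx_scal p (f a).
Proof.
by apply/ffunP => -[i j]; rewrite ffunE !smx_scalE; case: ifP; rewrite ?shom0.
Qed.

Lemma map_smx_shom : shom (@map_smx _ p _ _ f).
Proof.
split=> [X Y|X Y|c|b X].
- by apply/ffunP => ij; rewrite !ffunE (shomD hf).
- apply/ffunP => -[i j]; rewrite !(ffunE, smxME) shom_sum //.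
  by apply: eq_bigr => k _; rewrite (shomM hf) shom_ksign // !ffunE.
- by rewrite map_smx_scal (shom_kunit hf).
- by apply/ffunP => ij; rewrite !ffunE (shom_hpart hf).
Qed.

End Maps.

Section MapTwo.
Variables (A B : superAlgType K) (f : A -> B) (hf : shom f).
Variables (n : nat).
Local Notation p := (@qpar n).
Let F2 : QEnd n (QEnd n A) -> QEnd n (QEnd n B) := map_smx (map_smx f).

Lemma map_tens1 X : F2 (tens1 X) = tens1 (map_smx f X).
Proof.
have hs := map_smx_shom hf n; have hs2 := map_smx_shom hs n.
rewrite /F2 (shom_sum hs2); apply: eq_bigr => i _.
rewrite (shom_sum hs2); apply: eq_bigr => j _.
by rewrite (map_smx_unit hs) map_smx_scal // ffunE.
Qed.

Lemma map_tens2 X : F2 (tens2 X) = tens2 (map_smx f X).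
Proof.
have hs := map_smx_shom hf n; have hs2 := map_smx_shom hs n.
rewrite /F2 (shom_sum hs2); apply: eq_bigr => i _.
rewrite (shom_sum hs2); apply: eq_bigr => j _.
by rewrite (map_smx_scal hs) map_smx_unit // ffunE.
Qed.

Lemma map_Pmx s : F2 (Pmx n s) = Pmx n (f s).
Proof.
have hs := map_smx_shom hf n; have hs2 := map_smx_shom hs n.
rewrite /F2 (shom_sum hs2); apply: eq_bigr => i _.
rewrite (shom_sum hs2); apply: eq_bigr => j _.
by rewrite (map_smx_unit hs) map_smx_unit // shom_sign.
Qed.

Lemma map_Qmx s : F2 (Qmx n s) = Qmx n (f s).
Proof.
have hs := map_smx_shom hf n; have hs2 := map_smx_shom hs n.
rewrite /F2 (shom_sum hs2); apply: eq_bigr => i _.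
rewrite (shom_sum hs2); apply: eq_bigr => j _.
by rewrite (map_smx_unit hs) map_smx_unit // shom_sign.
Qed.

End MapTwo.

Section MapRelations.
Variables (A B : superAlgType K) (f : A -> B) (hf : shom f).
Variables (n : nat) (t : qgen n -> A).
Local Notation ft := (fun g => f (t g)).
Let f2 : fps (fps A) -> fps (fps B) := map_fps (map_fps f).
Let F2 : QEnd n (QEnd n (fps (fps A))) -> QEnd n (QEnd n (fps (fps B))) :=
  map_smx (map_smx f2).

Lemma map_tser i j : map_fps f (tser t i j) = tser ft i j.
Proof.
by apply: funext => -[|r]; rewrite /map_fps //=; case: ifP; rewrite ?shom0 ?shom1.
Qed.

Lemma map_in_u g : f2 (in_u g) = in_u (map_fps f g).
Proof. by apply: funext => r; rewrite /f2 {1}/map_fps /in_u map_fps_const. Qed.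

Lemma map_in_v g : f2 (in_v g) = in_v (map_fps f g).
Proof. by rewrite /f2 map_fps_const //; apply: map_fps_shom. Qed.

Lemma map_RTT_terms :
  [/\ F2 (Rser n A) = Rser n B,
      F2 (tens1 (Tser_u t)) = tens1 (Tser_u ft) &
      F2 (tens2 (Tser_v t)) = tens2 (Tser_v ft)].
Proof.
have h2 : shom f2 by do 2![apply: map_fps_shom].
have hs := map_smx_shom h2 n; have hs2 := map_smx_shom hs n.
split.
- have Ex : f2 (in_u (fps_uinv A)) = in_u (fps_uinv B).
    by rewrite map_in_u map_fps_uinv.
  have Ey : f2 (in_v (fps_uinv A)) = in_v (fps_uinv B).
    by rewrite map_in_v map_fps_uinv.
  rewrite /Rser; set x := in_u _ in Ex *; set y := in_v _ in Ey *.
  rewrite [LHS](shomB hs2); congr (_ - _); last first.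
  - rewrite [LHS](map_Qmx h2); congr (Qmx n).
    by rewrite (shomM h2 (_ * _)) (shomM h2 x) (shomB h2) Ex Ey.
  rewrite [LHS](shomB hs2); congr (_ - _).
  - rewrite [LHS](map_smx_scal hs); congr smx_scal.
    rewrite [LHS](map_smx_scal h2); congr smx_scal.
    by rewrite (shomB h2) !(shomX h2) Ex Ey.
  - rewrite [LHS](map_Pmx h2); congr (Pmx n).
    by rewrite (shomM h2 (_ * _)) (shomM h2 x) (shomD h2) Ex Ey.
- rewrite [LHS](map_tens1 h2); congr tens1.
  by apply/ffunP => ij; rewrite !ffunE map_in_u map_tser.
- rewrite [LHS](map_tens2 h2); congr tens2.
  by apply/ffunP => ij; rewrite !ffunE map_in_v map_tser.
Qed.

End MapRelations.
End Morphisms.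

Section YangianPresentation.
Variables (K : fieldType) (n : nat).

Lemma pext_shom (A : superAlgType K) (a : qgen n -> A) :
  queer_relations a -> shom (pext a : yangian K n -> A).
Proof.
move=> Ha; split; [exact: pext_add|exact: pext_mul|exact: pext_const|].
exact: pext_hpart.
Qed.

Lemma yangian_relations : queer_relations (@ygen K n).
Proof.
split=> [g|i j|].
- by apply: pext_inj => A a Ha; rewrite (shom_hpart (pext_shom Ha)) pext_gen //;
    case: Ha.
- apply: funext => r; apply: pext_inj => A a Ha; have hf := pext_shom Ha.
  case: (Ha) => _ /(_ i j) E _; have {E} := congr1 (fun g : fps A => g r) E.
  rewrite /fps_neg shom_sign //.
  have Eg k l : pext a (tser (@ygen K n) k l r) = tser a k l r.
    rewrite -[LHS]/(map_fps (pext a) _ r) map_tser //; congr (tser _ _ _ _).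
    by apply: funext => g; rewrite pext_gen.
  by rewrite !Eg.
- apply/ffunP => ij; apply/ffunP => kl; apply: funext => r; apply: funext => s.
  apply: pext_inj => A a Ha; have hf := pext_shom Ha.
  have [ER EU EV] := map_RTT_terms hf (@ygen K n).
  have Et : (fun g => pext a (@ygen K n g)) = a.
    by apply: funext => g; rewrite pext_gen.
  rewrite Et in EU EV.
  have h2 := map_fps_shom (map_fps_shom hf).
  have hs2 := map_smx_shom (map_smx_shom h2 n) n.
  case: (Ha) => _ _; rewrite -ER -EU -EV -!(shomM hs2).
  move/ffunP/(_ ij); rewrite !ffunE => /ffunP/(_ kl); rewrite !ffunE.
  by move/(congr1 (fun g : fps (fps A) => g r s)).
Qed.

Theorem yangian_universal (A : superAlgType K) (a : qgen n -> A) :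
  queer_relations a ->
  exists! f : yangian K n -> A, shom f /\ forall g, f (ygen K g) = a g.
Proof.
move=> Ha; exists (pext a); split.
  by split=> [|g]; [exact: pext_shom|exact: pext_gen].
move=> f [hf fg]; apply: funext => x.
have E s : f (\pi_(yangian K n)%qT s) = teval a s.
  elim: s => [g|c|s IHs u IHu|s IHs|s IHs u IHu|b s IHs] /=.
  - exact: fg.
  - exact: (shom_kunit hf).
  - by rewrite -IHs -IHu -(shomD hf); congr f; apply: pext_inj => A' a' Ha';
      rewrite (shomD (pext_shom Ha')) !pext_pi.
  - by rewrite -IHs -(shomN hf); congr f; apply: pext_inj => A' a' Ha';
      rewrite (shomN (pext_shom Ha')) !pext_pi.
  - by rewrite -IHs -IHu -(shomM hf); congr f; apply: pext_inj => A' a' Ha';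
      rewrite (shomM (pext_shom Ha')) !pext_pi.
  - by rewrite -IHs -(shom_hpart hf); congr f; apply: pext_inj => A' a' Ha';
      rewrite (shom_hpart (pext_shom Ha')) !pext_pi.
by rewrite -[RHS]/(f x) -[in RHS](reprK x) E.
Qed.

End YangianPresentation.

(* Main.v *)
(* The ternary relation rewritten as X_1(u) R Y_2(v) = Y_2(v) R X_1(u), with Y *)
(* inverse to X, gives supercommutators [x_ij(u), y_kl(v)] whose right-hand    *)
(* sides have the poles 1 / (u - v) and 1 / (u + v).  Summing them so that the *)
(* second pole drops out, and using str 1 = 0 before letting v tend to u, the  *)
(* first pole becomes a derivative: sum_j x_jk y_kj = 1 + str (dX Y) for each  *)
(* k.  For X = T this is z(u), and it also equals 1 + str (Y dX).              *)
(* All this applies to any corner of T cut out by an idempotent and its        *)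
(* inverse there.  Enlarging the corner P by one block Q, let h be the new     *)
(* diagonal block of the Gauss decomposition and e = pi_P Y h.  Then           *)
(* X (e + pi_Q) = h, so sum_j x_jk y_kj is the same sum for the pair           *)
(* (h, h^-1) corrected by terms x_ja e_ak y_kj.  Commuting e past x turns the  *)
(* correction into str (Y' dX_P) h_jk y_kj, where Y' is the inverse of the     *)
(* corner X_P of X.  Thus the series of X is the product of those of X_P and   *)
(* h, and the theorem follows by induction on the size of the corner.          *)

(* By [Lambda_tens], Nazarov's series is the sum over j of t_jk(u) times the (k, j) entry of
   T(u)^-1, for any positive index k. The same kind of sum is attached to every [corner_pair], that
   is to two matrices inverse to each other on a corner and linked by the mixed relation, and it is
   shown to be multiplicative along the Gauss decomposition.

   For one pair, the mixed relation amounts to the supercommutators of [pair_entry]. In suitable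
   sums of them unwanted terms get the coefficient sum_j (-1)^|j|, which is 0 because j and -j
   cancel ([alt_sum]). What remains has a numerator vanishing at v = u, so division by u - v turns
   into a derivative ([diag_limit]). This gives [column_diag]: sum_j x_jk y_kj = 1 + str (dX Y), the
   series [zser], while the analogous sums for two different blocks are 0. Summing over both indices
   gives str X(u) Y(v) = str Y(v) X(u) ([str_swap]), hence also the form 1 + str (Y dX) ([zserE]).

   Multiplicativity is [zser_step]. Let S be the disjoint union of P and Q, let h be the inverse of
   the Q-corner of Y, and let e = pi_P Y h. Since X (e + pi_Q) = h, column k in Q of X is that of h
   minus that of X e. Moving e to the left of X costs (z' - 1) h, where z' is the series of the
   P-corner ([commutator_sum]), and the terms with e on the left disappear by the off-diagonal case
   of [column_diag].

   The step is applied to the leading corners of T. The last diagonal block of the inverse of such a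
   corner is H_a^-1 ([minor_inv_corner]), and H_a with its inverse is again a corner pair
   ([diag_pair]). Differentiating H_a H_a^-1 = 1 turns its series into the factor of the theorem
   ([zser_rev], [zser_diag]). *)
From HB Require Import structures.
Require Import Defs.
From mathcomp Require Import all_boot all_order all_algebra.
From mathcomp Require Import boolp reals complex.

Set Implicit Arguments.
Unset Strict Implicit.
Unset Printing Implicit Defensive.

Import GRing.Theory.
Local Open Scope ring_scope.

(** * Even elements and power series *)

Section Even.
Variables (K : fieldType) (A : superAlgType K).
Implicit Types x y : A.

Definition even x := hpart false x = x.

Lemma hpartMn b x n : hpart b (x *+ n) = hpart b x *+ n.
Proof. by elim: n => [|n IH]; rewrite ?mulr0n ?hpart0 // !mulrS hpartD IH. Qed.

Lemma even_ksign x b : even x -> ksign b x = x.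
Proof. by move=> <-; rewrite ksign_hpart andbF mul1r. Qed.

Lemma evenD x y : even x -> even y -> even (x + y).
Proof. by move=> hx hy; rewrite /even hpartD hx hy. Qed.
Lemma evenN x : even x -> even (- x).
Proof. by move=> hx; rewrite /even hpartN hx. Qed.
Lemma evenB x y : even x -> even y -> even (x - y).
Proof. by move=> hx hy; apply: evenD => //; apply: evenN. Qed.
Lemma evenM x y : even x -> even y -> even (x * y).
Proof. by move=> hx hy; rewrite /even -hx -hy (hpart_mul false false). Qed.

Lemma mulr2n_eq0 x : (2%:R : K) != 0 -> x *+ 2 = 0 -> x = 0.
Proof.
move=> K2 E; rewrite -[x]mul1r -kunit1 -(mulVf K2) kunitM -mulrA.
have -> : kunit 2%:R = 1 + 1 :> A by rewrite kunitD kunit1.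
by rewrite mulrDl mul1r -mulr2n E mulr0.
Qed.

End Even.

Section Shom.
Variable K : fieldType.

Lemma even_shom (A B : superAlgType K) (f : A -> B) (x : A) :
  shom f -> even x -> even (f x).
Proof. by move=> hf hx; rewrite /even -(shom_hpart hf) hx. Qed.

Lemma fps_const_shom (A : superAlgType K) : shom (@fps_const K A).
Proof.
split=> [a b|a b|//|b a]; apply: funext => -[|r] //=.
- by rewrite fpsDE addr0.
- by rewrite fps_constME.
- by rewrite fps_constME mulr0.
- by rewrite /hpart /= /fps_hpart hpart0.
Qed.

Lemma in_u_shom (A : superAlgType K) : shom (@in_u K A).
Proof. exact: map_fps_shom (fps_const_shom A). Qed.

Lemma in_v_shom (A : superAlgType K) : shom (@in_v K A).
Proof. exact: fps_const_shom. Qed.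

Lemma smx_scal_shom (I : finType) (p : I -> bool) (A : superAlgType K) :
  shom (@smx_scal K I p A).
Proof.
split=> [a b|a b|//|b a]; apply/ffunP => -[i j].
- by rewrite smxDE !smx_scalE; case: ifP; rewrite ?addr0.
- rewrite smxME smx_scalE (bigD1 j) //= big1 => [|k kj].
    by rewrite !smx_scalE eqxx addbb ksign_id addr0; case: ifP; rewrite ?mul0r.
  by rewrite !smx_scalE (negPf kj) mulr0.
- rewrite ffunE /= !smx_scalE; case: eqP => [->|_]; last by rewrite hpart0.
  by rewrite -addbA addbb addbF.
Qed.

End Shom.

Section Fps.
Variables (K : fieldType) (A : superAlgType K).
Implicit Types f g : fps A.
Local Notation w := (fps_uinv A).

Lemma fpsMnE f n r : (f *+ n) r = f r *+ n.
Proof. by elim: n => [|n IH]; rewrite ?mulr0n // !mulrS fpsDE IH. Qed.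

Lemma uinvME f r : (w * f) r = if r is r'.+1 then f r' else 0.
Proof.
rewrite fpsME; case: r => [|r]; first by rewrite big_ord1 mul0r.
rewrite big_ord_recl big_ord_recl /= mul0r add0r mul1r big1 ?addr0 => [|i _].
  by rewrite /bump /= subSS subn0.
by rewrite mul0r.
Qed.

Lemma uinvC f : w * f = f * w.
Proof.
apply: funext => r; rewrite uinvME -[(f * w) r]/(fps_mul f w r) fps_mul_rev.
case: r => [|r]; first by rewrite big_ord1 mulr0.
rewrite big_ord_recl big_ord_recl /= mulr0 add0r mulr1 big1 ?addr0 => [|i _].
  by rewrite /bump /= subSS subn0.
by rewrite mulr0.
Qed.

Lemma uinv_inj f : w * f = 0 -> f = 0.
Proof. by move=> E; apply: funext => r; rewrite -[LHS](uinvME f r.+1) E. Qed.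

Lemma uinv_even : even w.
Proof.
rewrite /even; apply: funext => -[|[|r]];
  by rewrite /hpart /= /fps_hpart /= ?hpart0 ?hpart_one.
Qed.

Definition fps_tail f : fps A := fun r => f r.+1.

Lemma fps_split f : f = fps_const (f 0%N) + w * fps_tail f.
Proof.
by apply: funext => -[|r]; rewrite fpsDE uinvME ?addr0 // add0r.
Qed.

Lemma fps_derivD f g : fps_deriv (f + g) = fps_deriv f + fps_deriv g.
Proof.
apply: funext => -[|r]; rewrite fpsDE /fps_deriv ?addr0 //.
by rewrite fpsDE mulrnDl opprD.
Qed.

Lemma fps_deriv0 : fps_deriv (0 : fps A) = 0.
Proof. by apply: funext => -[|r] //=; rewrite mul0rn oppr0. Qed.

Lemma fps_derivN f : fps_deriv (- f) = - fps_deriv f.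
Proof. by apply: (addrI (fps_deriv f)); rewrite -fps_derivD !subrr fps_deriv0. Qed.

Lemma fps_deriv_sum (I : Type) (s : seq I) (P : pred I) (F : I -> fps A) :
  fps_deriv (\sum_(i <- s | P i) F i) = \sum_(i <- s | P i) fps_deriv (F i).
Proof. exact: (big_morph _ fps_derivD fps_deriv0). Qed.

Lemma fps_deriv_sign f (b : bool) : fps_deriv ((-1) ^+ b * f) = (-1) ^+ b * fps_deriv f.
Proof. by case: b; rewrite /= ?mulN1r ?fps_derivN ?mul1r. Qed.

Lemma fps_derivM f g : fps_deriv (f * g) = fps_deriv f * g + f * fps_deriv g.
Proof.
apply: funext => -[|r].
  by rewrite fpsDE !fpsME !big_ord1 mul0r mulr0 addr0.
rewrite fpsDE !fpsME big_ord_recl mul0r add0r [in X in _ + X]big_ord_recr /=.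
rewrite subnn mulr0 addr0 fpsME -sumrMnl -sumrN -big_split /=.
apply: eq_bigr => i _; have le_ir : (i <= r)%N by rewrite -ltnS.
rewrite add0n /bump add1n subSS subSn //=.
by rewrite mulNr mulrN mulrnAl mulrnAr -opprD -mulrnDr subnKC.
Qed.

Lemma fps_deriv_ksign f b : fps_deriv (ksign b f) = ksign b (fps_deriv f).
Proof.
have dh c : fps_deriv (hpart c f) = hpart c (fps_deriv f).
  apply: funext => -[|r]; rewrite /hpart /= /fps_hpart ?hpart0 //.
  by rewrite hpartN hpartMn.
by rewrite /ksign fps_derivD fps_deriv_sign !dh.
Qed.

Lemma fps_deriv_const a : fps_deriv (fps_const a : fps A) = 0.
Proof. by apply: funext => -[|[|r]] //=; rewrite ?mulr0n ?mul0rn oppr0. Qed.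

Lemma fps_deriv_uinv : fps_deriv w = - w ^+ 2.
Proof.
apply: funext => -[|[|[|r]]]; rewrite fpsNE expr2 uinvME /= ?mulr0n ?oppr0 //.
by rewrite mul0rn oppr0.
Qed.

End Fps.

(** * The substitution v := u in two-variable series *)

Section Diagonal.
Variables (K : fieldType) (A : superAlgType K).
Implicit Types (f g : fps (fps A)) (a b : fps A).
Local Notation w := (fps_uinv A).
Local Notation x := (in_u w).
Local Notation y := (in_v w).

(* the substitution v := u *)
Definition diag f : fps A := fun r => \sum_(i < r.+1) f i (r - i)%N.

Lemma in_u_uinv : x = fps_uinv (fps A).
Proof. by apply: funext => -[|[|r]] //; apply: funext => -[|s]. Qed.

Lemma in_uC f : x * f = f * x.
Proof. by rewrite in_u_uinv uinvC. Qed.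

Lemma in_vC f : y * f = f * y.
Proof. by apply: funext => r; rewrite fps_constME fpsMconstE uinvC. Qed.

Lemma diagD f g : diag (f + g) = diag f + diag g.
Proof. by apply: funext => r; rewrite fpsDE -big_split. Qed.

Lemma diag_in_v a : diag (in_v a) = a.
Proof.
apply: funext => r; rewrite /diag big_ord_recl subn0 big1 ?addr0 // => i _.
Qed.

Lemma diag_in_u a : diag (in_u a) = a.
Proof.
apply: funext => r; rewrite /diag big_ord_recr /= subnn /in_u /=.
rewrite big1 ?add0r // => i _; rewrite /fps_const.
by have := ltn_ord i; rewrite -subn_gt0; case: (r - i)%N.
Qed.

Lemma diag_xM f : diag (x * f) = w * diag f.
Proof.
apply: funext => -[|r]; rewrite uinvME /diag in_u_uinv.
  by rewrite big_ord1 uinvME.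
rewrite big_ord_recl uinvME add0r; apply: eq_bigr => i _.
by rewrite uinvME subSS.
Qed.

Lemma diag_split f : diag f = f 0%N + w * diag (fps_tail f).
Proof.
by rewrite {1}[f]fps_split -in_u_uinv diagD diag_xM -[RHS]/(_ + _) diag_in_v.
Qed.

(** Coefficients need not commute, but u^-1 is central: constant terms in u are split off and the
    induction runs on the degree of the coefficient. *)
Lemma diagM f g : diag (f * g) = diag f * diag g.
Proof.
have diag_vM a h : diag (in_v a * h) = a * diag h.
  apply: funext => r; elim: r h => [|r IH] h.
    by rewrite [RHS]fpsME /diag !big_ord1 fps_constME fpsME big_ord1.
  rewrite [X in _ * X]fps_split mulrDr -in_u_uinv diagD mulrA -in_uC -mulrA.
  rewrite -(shomM (in_v_shom A)) diag_in_v diag_xM fpsDE uinvME IH.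
  by rewrite (diag_split h) mulrDr mulrA -uinvC -mulrA fpsDE uinvME.
apply: funext => r; elim: r f => [|r IH] f.
  by rewrite [RHS]fpsME /diag !big_ord1 fpsME big_ord1 fpsME big_ord1.
rewrite [X in X * _]fps_split mulrDl -in_u_uinv -mulrA diagD diag_vM diag_xM.
by rewrite (diag_split f) mulrDl -mulrA !fpsDE !uinvME IH.
Qed.

Lemma diag_shom : shom diag.
Proof.
split; [exact: diagD|exact: diagM| |].
- by move=> c; rewrite -[RHS]diag_in_v.
- by move=> b f; apply: funext => r; rewrite -[RHS]/(hpart b (diag f r)) /diag hpart_big.
Qed.

Lemma fps_deriv_in_u a : fps_deriv (in_u a) = in_u (fps_deriv a).
Proof.
apply: funext => -[|r]; apply: funext => -[|s] //=.
- by rewrite fpsNE fpsMnE.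
- by rewrite fpsNE fpsMnE mul0rn oppr0.
Qed.

Lemma diag_deriv_uv a b :
  diag (fps_deriv (in_u a * in_v b)) = fps_deriv a * b.
Proof.
rewrite fps_derivM fps_deriv_const mulr0 addr0 diagM diag_in_v.
by rewrite fps_deriv_in_u diag_in_u.
Qed.

Lemma diag_deriv_vu a b :
  diag (fps_deriv (in_v a * in_u b)) = a * fps_deriv b.
Proof.
rewrite fps_derivM fps_deriv_const mul0r add0r diagM diag_in_v.
by rewrite fps_deriv_in_u diag_in_u.
Qed.

(** Comparing coefficients in y^2 f = x^2 f moves (r, s) to (r - 2, s + 2), and descent on r ends at
    0. Identities with cleared denominators can therefore be divided by y^2 - x^2 again. *)
Lemma in_uv_eq0 f : (y ^+ 2 - x ^+ 2) * f = 0 -> f = 0.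
Proof.
move=> E.
have F r s : (y ^+ 2 * f) r s.+2 = f r s.
  by rewrite expr2 -mulrA fps_constME fps_constME !uinvME.
have G r : (x ^+ 2 * f) r = if r is r'.+2 then f r' else 0.
  by rewrite in_u_uinv expr2 -mulrA uinvME; case: r => [|r] //; rewrite uinvME.
have {E} H r s : (y ^+ 2 * f) r s = (x ^+ 2 * f) r s.
  by apply/eqP; rewrite -subr_eq0 -!fpsNE -!fpsDE -mulrBl E.
apply: funext => r; apply: funext => s.
elim/ltn_ind: r s => r IH s; rewrite -F H G.
by case: r IH => [|[|r]] IH //; apply: IH.
Qed.

Hypothesis K2 : (2%:R : K) != 0.

(* Differentiating in u before setting v := u replaces the division by u - v. *)
Lemma diag_limit (C D E : fps (fps A)) :
  (y ^+ 2 - x ^+ 2) * C = x * y * (x + y) * D + x * y * (y - x) * E ->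
  diag D = 0 -> diag E = 0 -> diag C = diag (fps_deriv D).
Proof.
move=> /(congr1 (fun f => diag (fps_deriv f))) H D0 E0.
have dx : diag x = w by rewrite diag_in_u.
have dy : diag y = w by rewrite diag_in_v.
have hs := diag_shom.
have dM f g : diag (fps_deriv (f * g))
    = diag (fps_deriv f) * diag g + diag f * diag (fps_deriv g).
  by rewrite fps_derivM diagD !diagM.
(* In the product rule, the terms that differentiate the coefficients of [D] and [E] vanish by
   hypothesis. The derivatives of [C] and [E] come with y^2 - x^2 and x y (y - x), which are 0 at v
   = u. *)
rewrite fps_derivD diagD !(dM (_ - _)) (dM _ D) (dM _ E) D0 E0 !mulr0 in H.
rewrite !(shomM hs, shomB hs, shomD hs, shomX hs) !dx !dy in H.
rewrite !subrr !mulr0 mul0r !addr0 add0r in H.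
(* As x = u^-1, the derivative of -x^2 is 2 x^3; at v = u the coefficient of [D] is also 2 u^-3, so
   the two factors cancel. *)
have dx2 : fps_deriv (y ^+ 2 - x ^+ 2) = (x ^+ 3) *+ 2.
  rewrite fps_derivD fps_derivN !expr2 !fps_derivM fps_deriv_const.
  rewrite mul0r mulr0 addr0 add0r in_u_uinv fps_deriv_uinv.
  by rewrite mulrN mulNr -!exprSr -exprS opprD !opprK mulr2n.
have E3 : diag (x ^+ 3 *+ 2) = w ^+ 3 *+ 2.
  by rewrite mulr2n diagD (shomX hs) dx -mulr2n.
have E3' : w * w * (w + w) = w ^+ 3 *+ 2.
  by rewrite -mulr2n mulrnAr -expr2 -exprSr.
move: H; rewrite dx2 E3 E3' mul0r !addr0 => /eqP; rewrite -subr_eq0 -mulrBr.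
move/eqP; rewrite mulrnAl => /(mulr2n_eq0 K2).
rewrite !exprS expr0 mulr1 -!mulrA => /uinv_inj/uinv_inj/uinv_inj/eqP.
by rewrite subr_eq0 => /eqP.
Qed.

End Diagonal.

(** * Products with R in two tensor factors *)

Section Smx.
Variables (K : fieldType) (I : finType) (p : I -> bool) (A : superAlgType K).
Implicit Types X Y : smx p A.

Lemma ksign_sign (c b : bool) (x : A) : ksign b ((-1) ^+ c * x) = (-1) ^+ c * ksign b x.
Proof. by rewrite /ksign !hpart_sign mulrDr !mulrA -!signr_addb (addbC c). Qed.

Lemma evenE X i j b : even X ->
  ksign b (X (i, j)) = (-1) ^+ (b && (p i (+) p j)) * X (i, j).
Proof. by move=> <-; rewrite ffunE /= ksign_hpart. Qed.

Lemma ksign_smxE b X i j :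
  ksign b X (i, j) = (-1) ^+ (b && (p i (+) p j)) * ksign b (X (i, j)).
Proof.
have sgn (c : bool) Z : ((-1) ^+ c * Z : smx p A) (i, j) = (-1) ^+ c * Z (i, j).
  by rewrite !mulr_sign; case: c; rewrite ?smxNE.
rewrite /ksign smxDE sgn mulrDr mulrA -signr_addb !ffunE /=.
by case: b; case: (p i); case: (p j); rewrite /= ?mul1r ?mulN1r ?opprK // addrC.
Qed.

Lemma smx_scalME (a : A) X i j : even a -> (smx_scal p a * X) (i, j) = a * X (i, j).
Proof.
move=> ea; rewrite smxME (bigD1 i) //= big1 => [|k ki]; last first.
  by rewrite smx_scalE eq_sym (negPf ki) ksign0 mul0r.
by rewrite addr0 smx_scalE eqxx even_ksign.
Qed.

Lemma smx_MscalE (a : A) X i j : (X * smx_scal p a) (i, j) = X (i, j) * a.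
Proof.
rewrite smxME (bigD1 j) //= big1 => [|k kj]; last first.
  by rewrite smx_scalE (negPf kj) mulr0.
by rewrite addr0 smx_scalE eqxx addbb ksign_id.
Qed.

Lemma smx_unit_sumE (f : I -> I -> A) i j :
  (\sum_k \sum_l smx_unit p k l (f k l)) (i, j) = f i j.
Proof.
have unitE k l a : smx_unit p k l a (i, j) = if (i, j) == (k, l) then a else 0.
  exact: ffunE.
rewrite smx_sumE (bigD1 i) //= smx_sumE (bigD1 j) //= unitE eqxx.
rewrite big1 => [|l lj]; last by rewrite unitE xpair_eqE eqxx eq_sym (negPf lj).
rewrite big1 => [|k ki]; first by rewrite !addr0.
by rewrite smx_sumE big1 // => l _; rewrite unitE xpair_eqE eq_sym (negPf ki).
Qed.

End Smx.

Section Neg.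
Variable n : nat.
Implicit Types i j : qidx n.

Lemma qnegK : involutive (@qneg n).
Proof. by move=> [b c]; rewrite /qneg negbK. Qed.

Lemma qneg_eq i j : (i == qneg j) = (qneg i == j).
Proof. by apply/eqP/eqP => [->|<-]; rewrite qnegK. Qed.

End Neg.

Section Two.
Variables (K : fieldType) (n : nat) (S : superAlgType K).
Local Notation p := (@qpar n).
Implicit Types (X Y : QEnd n S) (Z : QEnd n (QEnd n S)) (a : S).
Implicit Types i j k l m q : qidx n.

Lemma tens1E X i j k l :
  tens1 X (i, j) (k, l) = if k == l then X (i, j) else 0.
Proof.
by rewrite /tens1 (smx_unit_sumE p (fun i j => smx_scal p (X (i, j)))) smx_scalE.
Qed.

Lemma tens1_map X : tens1 X = map_smx (smx_scal p) X.
Proof.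
apply/ffunP => -[i j]; apply/ffunP => -[k l].
by rewrite tens1E ffunE smx_scalE.
Qed.

Lemma tens2_scal X : tens2 X = smx_scal p X.
Proof.
have hs := smx_scal_shom p (QEnd n S).
rewrite /tens2; transitivity (smx_scal p (\sum_i \sum_j smx_unit p i j (X (i, j)))).
  by rewrite (shom_sum hs); apply: eq_bigr => i _; rewrite (shom_sum hs).
congr smx_scal; apply/ffunP => -[i j].
exact: (smx_unit_sumE p (fun i j => X (i, j))).
Qed.

Lemma tens2E X i j k l :
  tens2 X (i, j) (k, l) = if i == j then X (k, l) else 0.
Proof. by rewrite tens2_scal smx_scalE; case: ifP; rewrite ?smx0E. Qed.

Lemma tens1_shom : shom (@tens1 K n S).
Proof.
have -> : @tens1 K n S = map_smx (smx_scal p) by apply: funext => X; apply: tens1_map.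
exact: map_smx_shom (smx_scal_shom _ _) n.
Qed.

Lemma tens2_shom : shom (@tens2 K n S).
Proof.
have -> : @tens2 K n S = smx_scal p by apply: funext => X; apply: tens2_scal.
exact: smx_scal_shom.
Qed.

Lemma tens21E X Y i m k q : even X ->
  (tens2 X * tens1 Y) (i, m) (k, q) = X (k, q) * Y (i, m).
Proof.
move=> eX; rewrite smxME smx_sumE (bigD1 i) //= big1 => [|j ji]; last first.
  by rewrite tens2_scal smx_scalE eq_sym (negPf ji) ksign0 mul0r smx0E.
rewrite addr0 tens2_scal smx_scalE eqxx even_ksign // smxME (bigD1 q) //=.
rewrite big1 => [|l lq]; last by rewrite tens1E (negPf lq) mulr0.
by rewrite addr0 tens1E eqxx addbb ksign_id.
Qed.

Lemma tens12E X Y i m k q : even X ->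
  (tens1 X * tens2 Y) (i, m) (k, q)
    = (-1) ^+ ((p k (+) p q) && (p i (+) p m)) * (X (i, m) * Y (k, q)).
Proof.
move=> eX; rewrite smxME smx_sumE (bigD1 m) //= big1 => [|j ji]; last first.
  by rewrite tens2_scal smx_scalE (negPf ji) mulr0 smx0E.
rewrite addr0 tens2_scal smx_scalE eqxx addbb ksign_id smxME (bigD1 k) //=.
rewrite big1 => [|l lk]; last by rewrite tens1E eq_sym (negPf lk) ksign0 mul0r.
by rewrite addr0 tens1E eqxx evenE // mulrA.
Qed.

Lemma smx2_subE2 Z1 Z2 Z3 i j k l :
  (Z1 - Z2 - Z3) (i, j) (k, l) = Z1 (i, j) (k, l) - Z2 (i, j) (k, l) - Z3 (i, j) (k, l).
Proof. by do 2![rewrite smxDE smxNE smxDE smxNE]. Qed.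

Section Swap.
Variable a : S.
Hypotheses (a_even : even a) (aC : forall b, a * b = b * a).

Lemma PmxE i j k l :
  Pmx n a (i, j) (k, l)
    = if (k == j) && (l == i) then (-1) ^+ p j * a else 0.
Proof.
rewrite /Pmx (smx_unit_sumE p (fun i j => smx_unit p j i ((-1) ^+ p j * a))).
by rewrite ffunE xpair_eqE.
Qed.

Lemma QmxE i j k l :
  Qmx n a (i, j) (k, l)
    = if (k == qneg j) && (l == qneg i) then (-1) ^+ p j * a else 0.
Proof.
rewrite /Qmx (smx_unit_sumE p (fun i j =>
  smx_unit p (qneg j) (qneg i) ((-1) ^+ p j * a))).
by rewrite ffunE xpair_eqE.
Qed.

Lemma mulPE Z i m k q :
  (Z * Pmx n a) (i, m) (k, q)
    = (-1) ^+ (((p q (+) p m) && (p k (+) p m)) (+) p m) * (Z (i, q) (k, m) * a).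
Proof.
rewrite smxME smx_sumE (bigD1 q) //= big1 => [|j jq]; last first.
  rewrite smxME big1 // => l _; rewrite PmxE [q == j]eq_sym (negPf jq) andbF.
  by rewrite mulr0.
rewrite addr0 smxME (bigD1 m) //= big1 => [|l lm]; last first.
  by rewrite PmxE (negPf lm) mulr0.
rewrite addr0 PmxE !eqxx /= ksign_smxE ksign_sign ksignK (addbC (p m)) addbb.
rewrite ksign_id !mulr_sign; case: (p m); case: (p k); case: (p q);
  by rewrite /= ?(mulrN, mulNr, opprK).
Qed.

Lemma Pmul_E Z i m k q :
  (Pmx n a * Z) (i, m) (k, q)
    = (-1) ^+ (((p k (+) p m) && (p k (+) p i)) (+) p k) * (a * Z (k, m) (i, q)).
Proof.
rewrite smxME smx_sumE (bigD1 k) //= big1 => [|j jk]; last first.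
  rewrite smxME big1 // => l _; rewrite ksign_smxE PmxE [k == j]eq_sym (negPf jk).
  by rewrite ksign0 mulr0 ksign0 mul0r.
rewrite addr0 smxME (bigD1 i) //= big1 => [|l li]; last first.
  by rewrite ksign_smxE PmxE (negPf li) andbF ksign0 mulr0 ksign0 mul0r.
rewrite addr0 ksign_smxE PmxE !eqxx /= !ksign_sign !(even_ksign _ a_even).
rewrite !mulr_sign; case: (p m); case: (p k); case: (p i);
  by rewrite /= ?(mulrN, mulNr, opprK).
Qed.

Lemma mulQE Z i m k q :
  (Z * Qmx n a) (i, m) (k, q)
    = (-1) ^+ (((p q (+) p m (+) true) && (p k (+) p m (+) true)) (+) p m)
      * (Z (i, qneg q) (k, qneg m) * a).
Proof.
rewrite smxME smx_sumE (bigD1 (qneg q)) //= big1 => [|j jq]; last first.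
  rewrite smxME big1 // => l _; rewrite QmxE [q == _]qneg_eq [_ == j]eq_sym (negPf jq) andbF.
  by rewrite mulr0.
rewrite addr0 smxME (bigD1 (qneg m)) //= big1 => [|l lm]; last first.
  by rewrite QmxE (negPf lm) mulr0.
rewrite addr0 QmxE qnegK !eqxx /= ksign_smxE ksign_sign ksignK.
rewrite !mulr_sign /qpar /=; case: (m.1); case: (k.1); case: (q.1);
  by rewrite /= ksign_id ?(mulrN, mulNr, opprK).
Qed.

Lemma Qmul_E Z i m k q :
  (Qmx n a * Z) (i, m) (k, q)
    = (-1) ^+ (((p k (+) p m (+) true) && (p k (+) p i (+) true)) (+) p k (+) true)
      * (a * Z (qneg k, m) (qneg i, q)).
Proof.
rewrite smxME smx_sumE (bigD1 (qneg k)) //= big1 => [|j jk]; last first.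
  rewrite smxME big1 // => l _; rewrite ksign_smxE QmxE [k == _]qneg_eq [_ == j]eq_sym (negPf jk).
  by rewrite ksign0 mulr0 ksign0 mul0r.
rewrite addr0 smxME (bigD1 (qneg i)) //= big1 => [|l li]; last first.
  by rewrite ksign_smxE QmxE (negPf li) andbF ksign0 mulr0 ksign0 mul0r.
rewrite addr0 ksign_smxE QmxE qnegK !eqxx /= !ksign_sign !(even_ksign _ a_even).
rewrite !mulr_sign /qpar /=; case: (m.1); case: (k.1); case: (i.1);
  by rewrite /= ?(mulrN, mulNr, opprK).
Qed.

Definition smx_flip X : QEnd n S := [ffun ij => X (qneg ij.1, qneg ij.2)].

Lemma tens2P X : tens2 X * Pmx n a = Pmx n a * tens1 X.
Proof.
apply/ffunP => -[i m]; apply/ffunP => -[k q].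
rewrite mulPE Pmul_E tens1E tens2E; case: eqP => [->|]; last first.
  by rewrite mul0r !mulr0.
rewrite -aC; congr (_ * _); congr (_ ^+ _).
by case: (p _); case: (p m); case: (p k).
Qed.

Lemma tens1P X : tens1 X * Pmx n a = Pmx n a * tens2 X.
Proof.
apply/ffunP => -[i m]; apply/ffunP => -[k q].
rewrite mulPE Pmul_E tens1E tens2E; case: eqP => [->|]; last first.
  by rewrite mul0r !mulr0.
rewrite -aC addbb; congr (_ * _); congr (_ ^+ _).
by case: (p _); case: (p m); case: (p q).
Qed.

Lemma tens2Q X : tens2 X * Qmx n a = Qmx n a * tens1 (smx_flip X).
Proof.
apply/ffunP => -[i m]; apply/ffunP => -[k q].
rewrite mulQE Qmul_E tens1E tens2E ffunE /= qnegK -qneg_eq.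
case: eqP => [->|]; last by rewrite mul0r !mulr0.
rewrite -aC; congr (_ * _); congr (_ ^+ _).
by rewrite /qpar /=; case: (q.1); case: (m.1); case: (k.1).
Qed.

Lemma tens1Q X : tens1 (smx_flip X) * Qmx n a = Qmx n a * tens2 X.
Proof.
apply/ffunP => -[i m]; apply/ffunP => -[k q].
rewrite mulQE Qmul_E tens1E tens2E ffunE /= qnegK -qneg_eq.
case: eqP => [->|]; last by rewrite mul0r !mulr0.
rewrite -aC; congr (_ * _); congr (_ ^+ _).
by rewrite /qpar /=; case: (q.1); case: (m.1); case: (i.1).
Qed.

End Swap.

Section Exchange.
Variables c a b : S.
Hypotheses (c_even : even c) (a_even : even a) (b_even : even b).
Hypotheses (cC : forall x, c * x = x * c) (aC : forall x, a * x = x * a).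
Hypothesis bC : forall x, b * x = x * b.

Local Notation Rmx := (smx_scal p (smx_scal p c) - Pmx n a - Qmx n b).

Lemma scal2ME Z i m k q :
  (smx_scal p (smx_scal p c) * Z) (i, m) (k, q) = c * Z (i, m) (k, q).
Proof.
rewrite smx_scalME ?smx_scalME //.
exact: even_shom (smx_scal_shom p S) c_even.
Qed.

Lemma scal2C Z : smx_scal p (smx_scal p c) * Z = Z * smx_scal p (smx_scal p c).
Proof.
apply/ffunP => -[i m]; apply/ffunP => -[k q]; rewrite scal2ME.
by rewrite !smx_MscalE cC.
Qed.

(** Passing N through the two swap operators carries it to the first tensor factor, where it
    multiplies X; the second operator also negates indices, hence [smx_flip]. Each entry is then a
    product of one entry from each factor. In [Rmul_right] it is L that changes factor. *)
Lemma Rmul_left L X N i m k q : even L -> even X ->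
  (tens2 L * tens1 X * Rmx * tens2 N) (i, m) (k, q)
  = c * (tens2 L * tens1 X * tens2 N) (i, m) (k, q)
    - a * ((-1) ^+ (((p q (+) p m) && (p k (+) p m)) (+) p m)
           * (L (k, m) * (X * N) (i, q)))
    - b * ((-1) ^+ (((p q (+) p m (+) true) && (p k (+) p m (+) true)) (+) p m)
           * (L (k, qneg m) * (X * smx_flip N) (i, qneg q))).
Proof.
move=> eL eX; have h1 := tens1_shom.
rewrite !mulrBr !mulrBl -scal2C -!mulrA -(tens1P a_even aC) -(tens1Q b_even bC).
rewrite !(mulrA (tens1 X)) -!(shomM h1) !(mulrA (tens2 L)).
rewrite smx2_subE2 scal2ME; move: (tens2 L * tens1 X * tens2 N) => Z0.
rewrite mulPE mulQE.
rewrite (tens21E (X * N) _ _ _ _ eL) (tens21E (X * smx_flip N) _ _ _ _ eL) aC bC.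
by rewrite -!mulrA.
Qed.

Lemma Rmul_right L X N i m k q : even L -> even X -> even N ->
  (tens2 L * Rmx * tens1 X * tens2 N) (i, m) (k, q)
  = c * (tens2 L * tens1 X * tens2 N) (i, m) (k, q)
    - a * ((-1) ^+ (((p k (+) p m) && (p k (+) p q)) (+) p k)
           * ((L * X) (k, m) * N (i, q)))
    - b * ((-1) ^+ (((p k (+) p m (+) true) && (p k (+) p q)) (+) p k (+) true)
           * ((smx_flip L * X) (qneg k, m) * N (qneg i, q))).
Proof.
move=> eL eX eN; have h1 := tens1_shom.
have eF : even (smx_flip L).
  by rewrite /even; apply/ffunP => -[k' l]; rewrite !ffunE /= -{2}eL ffunE /=
    /qpar /=; congr hpart; case: (k'.1); case: (l.1).
rewrite !mulrBr !mulrBl -scal2C (tens2P a_even aC) (tens2Q b_even bC).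
rewrite -(mulrA (Pmx n a)) -(mulrA (Qmx n b)) -!(shomM h1).
rewrite -(mulrA (Pmx n a)) -(mulrA (Qmx n b)) -!(mulrA (smx_scal _ _)).
have e1 : even (L * X) by apply: evenM.
have e2 : even (smx_flip L * X) by apply: evenM.
rewrite smx2_subE2 scal2ME; move: (tens2 L * tens1 X * tens2 N) => Z0.
have sgn (s t : bool) (e f g : S) :
    (-1) ^+ s * (e * ((-1) ^+ t * (f * g))) = e * ((-1) ^+ (s (+) t) * (f * g)).
  by rewrite !mulr_sign; case: s; case: t; rewrite /= ?(mulrN, opprK).
congr (_ - _ - _).
- rewrite Pmul_E // tens12E // sgn; congr (_ * (_ ^+ _ * _)).
  by case: (p m); case: (p k); case: (p q); case: (p i).
- rewrite Qmul_E // tens12E // sgn; congr (_ * (_ ^+ _ * _)).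
  by rewrite /qpar /=; case: (m.1); case: (k.1); case: (q.1); case: (i.1).
Qed.
End Exchange.
End Two.

(** * The ternary relation on a corner *)

Section Proj.
Variables (K : fieldType) (n : nat) (A : superAlgType K).
Implicit Types (S : {set 'I_n}) (X Y : QEnd n A) (i j : qidx n).

Definition proj S : QEnd n A :=
  [ffun ij => if (ij.1 == ij.2) && (ij.1.2 \in S) then 1 else 0].

Lemma projE S i j : proj S (i, j) = if (i == j) && (i.2 \in S) then 1 else 0.
Proof. exact: ffunE. Qed.

Lemma projM S X i j : (proj S * X) (i, j) = if i.2 \in S then X (i, j) else 0.
Proof.
rewrite smxME (bigD1 i) //= big1 => [|k ki]; last first.
  by rewrite projE eq_sym (negPf ki) ksign0 mul0r.
by rewrite addr0 projE eqxx /=; case: ifP; rewrite ?ksign_one ?ksign0 (mul1r, mul0r).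
Qed.

Lemma Mproj S X i j : (X * proj S) (i, j) = if j.2 \in S then X (i, j) else 0.
Proof.
rewrite smxME (bigD1 j) //= big1 => [|k kj]; last first.
  by rewrite projE (negPf kj) mulr0.
by rewrite addr0 projE eqxx addbb ksign_id /=; case: ifP; rewrite (mulr1, mulr0).
Qed.

Lemma proj_mul S T : proj S * proj T = proj (S :&: T).
Proof.
apply/ffunP => -[i j]; rewrite projM !projE inE.
by case: (i.2 \in S); rewrite ?andbF.
Qed.

Lemma proj_even S : even (proj S).
Proof.
apply/ffunP => -[i j]; rewrite ffunE projE /=; case: eqP => [->|_].
  by rewrite addbb; case: ifP; rewrite ?hpart_one ?hpart0.
by rewrite hpart0.
Qed.

Lemma flip_proj S : smx_flip (proj S) = proj S.
Proof.
apply/ffunP => -[i j]; rewrite ffunE !projE /=; congr (if _ && _ then _ else _).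
by rewrite (inj_eq (inv_inj (@qnegK n))).
Qed.

End Proj.
Arguments proj {K n A} S.

Section TensProj.
Variables (K : fieldType) (n : nat) (B : superAlgType K).
Implicit Types (S : {set 'I_n}) (Z : QEnd n B).

Lemma tens1_proj S : tens1 (proj S : QEnd n B) = proj S.
Proof.
apply/ffunP => -[i j]; apply/ffunP => -[k l]; rewrite tens1E !projE.
by case: ((i == j) && _); rewrite ?smx1E ?smx0E //; case: ifP.
Qed.

Lemma tens1_projC S Z : GRing.comm (tens1 (proj S)) (tens2 Z).
Proof.
rewrite tens1_proj; apply/ffunP => -[i m].
rewrite projM Mproj tens2_scal smx_scalE; case: eqP => [->//|_].
by case: ifP; case: ifP.
Qed.

Lemma tens2_projC S Z : GRing.comm (tens2 (proj S)) (tens1 Z).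
Proof.
rewrite /GRing.comm tens2_scal; apply/ffunP => -[i m].
rewrite smx_MscalE smx_scalME; last exact: proj_even.
rewrite tens1_map /map_smx ffunE.
apply/ffunP => -[k q]; rewrite projM Mproj smx_scalE.
by case: eqP => [->//|_]; case: ifP; case: ifP.
Qed.

Section Rmx.
Variables c a b : B.
Hypotheses (a_even : even a) (b_even : even b).
Hypotheses (aC : forall x, a * x = x * a) (bC : forall x, b * x = x * b).
Hypotheses (c_even : even c) (cC : forall x, c * x = x * c).
Local Notation p := (@qpar n).
Local Notation P1 S := (tens1 (proj S : QEnd n B)).
Local Notation P2 S := (tens2 (proj S : QEnd n B)).

Lemma proj_Pmx S : P1 S * P2 S * Pmx n a = Pmx n a * (P1 S * P2 S).
Proof.
rewrite -mulrA (tens2P a_even aC) mulrA (tens1P a_even aC) -mulrA.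
by rewrite tens2_projC.
Qed.

Lemma proj_Qmx S : P1 S * P2 S * Qmx n b = Qmx n b * (P1 S * P2 S).
Proof.
rewrite -mulrA (tens2Q b_even bC) flip_proj mulrA.
by rewrite -{1}flip_proj (tens1Q b_even bC) -mulrA tens2_projC.
Qed.

(** The swap operators exchange the tensor factors, so it is the product of the projections in both
    factors that passes through R. For the second operator one also uses that a union of blocks is
    stable under i -> -i ([flip_proj]). *)
Lemma proj_Rmx S :
  P1 S * P2 S * (smx_scal p (smx_scal p c) - Pmx n a - Qmx n b)
  = (smx_scal p (smx_scal p c) - Pmx n a - Qmx n b) * (P1 S * P2 S).
Proof.
by rewrite !mulrBr !mulrBl proj_Pmx proj_Qmx (scal2C c_even cC).
Qed.

End Rmx.
End TensProj.

Section Corner.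
Variables (K : fieldType) (n : nat) (A : superAlgType K).
Local Notation p := (@qpar n).
Local Notation B := (fps (fps A)).
Local Notation x := (in_u (fps_uinv A)).
Local Notation y := (in_v (fps_uinv A)).
Local Notation R := (Rser n A).
Implicit Types (S : {set 'I_n}) (X Y L M N : QEnd n (fps A)).
Implicit Types i j k m q : qidx n.

(* U X and V X stand for X^1(u) and X^2(v). *)
Definition at_u X : QEnd n B := map_smx (@in_u K A) X.
Definition at_v X : QEnd n B := map_smx (@in_v K A) X.
Definition U X := tens1 (at_u X).
Definition V X := tens2 (at_v X).

Local Notation pi S := (proj S : QEnd n (fps A)).

Lemma at_u_shom : shom at_u.
Proof. exact: map_smx_shom (in_u_shom A) n. Qed.
Lemma at_v_shom : shom at_v.
Proof. exact: map_smx_shom (in_v_shom A) n. Qed.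

Lemma shom_comp (A1 A2 A3 : superAlgType K) (f : A1 -> A2) (g : A2 -> A3) :
  shom f -> shom g -> shom (fun z => g (f z)).
Proof.
move=> hf hg; split=> [a b|a b|c|b a].
- by rewrite (shomD hf) (shomD hg).
- by rewrite (shomM hf) (shomM hg).
- by rewrite (shom_kunit hf) (shom_kunit hg).
- by rewrite (shom_hpart hf) (shom_hpart hg).
Qed.

Lemma U_shom : shom U.
Proof. exact: shom_comp at_u_shom (tens1_shom _ _). Qed.
Lemma V_shom : shom V.
Proof. exact: shom_comp at_v_shom (tens2_shom _ _). Qed.

Lemma at_u_proj S : at_u (pi S) = proj S.
Proof.
apply/ffunP => -[i j]; rewrite ffunE !projE.
by case: ifP; rewrite ?(shom1 (in_u_shom A)) ?(shom0 (in_u_shom A)).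
Qed.
Lemma at_v_proj S : at_v (pi S) = proj S.
Proof.
apply/ffunP => -[i j]; rewrite ffunE !projE.
by case: ifP; rewrite ?(shom1 (in_v_shom A)) ?(shom0 (in_v_shom A)).
Qed.

Lemma x_even : even x. Proof. exact: even_shom (in_u_shom A) (uinv_even A). Qed.
Lemma y_even : even y. Proof. exact: even_shom (in_v_shom A) (uinv_even A). Qed.

Definition Rc : B := y ^+ 2 - x ^+ 2.
Definition Ra : B := x * y * (x + y).
Definition Rb : B := x * y * (y - x).

Lemma Rc_even : even Rc.
Proof.
by apply: evenB; rewrite expr2; apply: evenM; (apply: x_even || apply: y_even).
Qed.
Lemma Ra_even : even Ra.
Proof.
do !apply: evenM; [exact: x_even|exact: y_even|].
by apply: evenD; [exact: x_even|exact: y_even].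
Qed.
Lemma Rb_even : even Rb.
Proof.
do !apply: evenM; [exact: x_even|exact: y_even|].
by apply: evenB; [exact: y_even|exact: x_even].
Qed.

Lemma comm_x f : GRing.comm f x. Proof. by rewrite /GRing.comm in_uC. Qed.
Lemma comm_y f : GRing.comm f y. Proof. by rewrite /GRing.comm in_vC. Qed.
Lemma RcC f : Rc * f = f * Rc.
Proof. by symmetry; apply: commrB; apply: commrX; [apply: comm_y|apply: comm_x]. Qed.
Lemma RaC f : Ra * f = f * Ra.
Proof.
symmetry; apply: commrM; first by apply: commrM; [apply: comm_x|apply: comm_y].
by apply: commrD; [apply: comm_x|apply: comm_y].
Qed.
Lemma RbC f : Rb * f = f * Rb.
Proof.
symmetry; apply: commrM; first by apply: commrM; [apply: comm_x|apply: comm_y].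
by apply: commrB; [apply: comm_y|apply: comm_x].
Qed.

Lemma RserE : R = smx_scal p (smx_scal p Rc) - Pmx n Ra - Qmx n Rb.
Proof. by []. Qed.

Definition UV S := U (pi S) * V (pi S).

Lemma U_projC S X : GRing.comm (U (pi S)) (V X).
Proof. by rewrite /U at_u_proj; apply: tens1_projC. Qed.
Lemma V_projC S X : GRing.comm (V (pi S)) (U X).
Proof. by rewrite /V at_v_proj; apply: tens2_projC. Qed.

Lemma UV_R S : UV S * R = R * UV S.
Proof.
rewrite /UV RserE /U /V at_u_proj at_v_proj.
exact: (proj_Rmx Ra_even Rb_even RaC RbC Rc_even RcC).
Qed.

Lemma mul_UprojE S Z i m : i.2 \in S -> (U (pi S) * Z) (i, m) = Z (i, m).
Proof. by move=> iS; rewrite /U at_u_proj tens1_proj projM iS. Qed.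
Lemma Uproj_mulE S Z i m : m.2 \in S -> (Z * U (pi S)) (i, m) = Z (i, m).
Proof. by move=> iS; rewrite /U at_u_proj tens1_proj Mproj iS. Qed.

Lemma U_cut S (Z1 Z2 : QEnd n (QEnd n B)) i m : i.2 \in S -> m.2 \in S ->
  Z1 * U (pi S) = U (pi S) * Z2 -> Z1 (i, m) = Z2 (i, m).
Proof.
by move=> iS mS E; rewrite -(Uproj_mulE _ _ mS) E mul_UprojE.
Qed.

(* X^1(u) R Y^2(v) = Y^2(v) R X^1(u) on the corner cut out by S. *)
Definition mixed S X Y :=
  V (pi S) * (U X * R * V Y) * U (pi S) = U (pi S) * (V Y * R * U X) * V (pi S).

(** Factors inserted at both ends in the second tensor factor absorb the projections [vp] and
    commute with the projection [up] of the first. *)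
Lemma sandwich (T : pzRingType) (vl vn up vp ux r vy : T) :
  vp * (ux * r * vy) * up = up * (vy * r * ux) * vp ->
  vl * vp = vl -> vp * vn = vn -> GRing.comm up vl -> GRing.comm up vn ->
  vl * ux * r * (vy * vn) * up = up * (vl * vy * r * ux * vn).
Proof.
move=> E lv vn' ul un.
transitivity (vl * (vp * (ux * r * vy) * up) * vn).
  by rewrite -[RHS]mulrA -[in RHS](mulrA _ up) un !mulrA lv.
by rewrite E !mulrA -ul -!mulrA vn'.
Qed.

Lemma balance (T : pzRingType) (c a b P Q s1 s2 t1 t2 : T) :
  c * P - a * s1 - b * t1 = c * Q - a * s2 - b * t2 ->
  c * (P - Q) = a * (s1 - s2) + b * (t1 - t2).
Proof.
move=> /eqP; rewrite subr_eq => /eqP E; rewrite !mulrBr.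
apply/eqP; rewrite subr_eq -[c * P](subrK (a * s1)) E; apply/eqP.
by rewrite addrC !addrA addrAC [RHS]addrC !addrA [a * s1 + _]addrC.
Qed.

(** The mixed relation multiplied by L on the left and N on the right in the second factor. Taking
    both equal to pi_S yields the supercommutators of X and Y; [commutator_sum] takes Schur
    complement data instead. *)
Lemma mixed_entry S X Y L N LY YN i m k q (s t : B) :
  even X -> even L -> even N -> even (L * Y) ->
  L * pi S = L -> pi S * N = N -> L * Y = LY -> Y * N = YN -> mixed S X Y ->
  i.2 \in S -> m.2 \in S ->
  (V L * U X * V YN) (i, m) (k, q) = s -> (V LY * U X * V N) (i, m) (k, q) = t ->
  Rc * (s - t)
  = Ra * ((-1) ^+ (((p q (+) p m) && (p k (+) p m)) (+) p m)
           * (at_v L (k, m) * (at_u X * at_v YN) (i, q))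
        - (-1) ^+ (((p k (+) p m) && (p k (+) p q)) (+) p k)
           * ((at_v LY * at_u X) (k, m) * at_v N (i, q)))
  + Rb * ((-1) ^+ (((p q (+) p m (+) true) && (p k (+) p m (+) true)) (+) p m)
           * (at_v L (k, qneg m) * (at_u X * smx_flip (at_v YN)) (i, qneg q))
        - (-1) ^+ (((p k (+) p m (+) true) && (p k (+) p q)) (+) p k (+) true)
           * ((smx_flip (at_v LY) * at_u X) (qneg k, m) * at_v N (qneg i, q))).
Proof.
move=> eX eL eN eLY LS NS <- <- XY iS mS <- <- {s t}.
have hU := U_shom; have hV := V_shom.
have eu Z : even Z -> even (at_u Z) by apply: even_shom at_u_shom.
have ev Z : even Z -> even (at_v Z) by apply: even_shom at_v_shom.
(* The projections of the second factor are absorbed by L and N, those of the first are invisible at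
   entries (i, m) with both indices in S. *)
have E : (V L * U X * R * V (Y * N)) (i, m) = (V (L * Y) * R * U X * V N) (i, m).
  have LS' : V L * V (pi S) = V L by rewrite -(shomM hV) LS.
  have NS' : V (pi S) * V N = V N by rewrite -(shomM hV) NS.
  apply: (U_cut iS mS); rewrite (shomM hV Y) (shomM hV L).
  exact: (sandwich XY LS' NS' (U_projC S L) (U_projC S N)).
have {E} := congr1 (fun Z : QEnd n B => Z (k, q)) E.
rewrite RserE.
have E1 := Rmul_left Rc_even Ra_even Rb_even RcC RaC RbC (at_v (Y * N))
  i m k q (ev L eL) (eu X eX).
have E2 := Rmul_right Rc_even Ra_even Rb_even RcC RaC RbC i m k q
  (ev (L * Y) eLY) (eu X eX) (ev N eN).
move=> E; apply: balance; exact: (etrans (esym E1) (etrans E E2)).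
Qed.

End Corner.

(** * Supercommutators and the series of a corner pair *)

Lemma absorbl (T : pzRingType) (e u v : T) :
  GRing.comm e u -> e * v = v -> e * u * v = u * v.
Proof. by move=> -> ev; rewrite -mulrA ev. Qed.

Lemma absorbr (T : pzRingType) (e u v : T) :
  GRing.comm e u -> v * e = v -> v * u * e = v * u.
Proof. by move=> eu ve; rewrite -mulrA -eu mulrA ve. Qed.

Lemma mul_signC (T : pzRingType) (a x : T) (b : bool) :
  a * ((-1) ^+ b * x) = (-1) ^+ b * (a * x).
Proof. by rewrite !mulr_sign; case: b; rewrite ?mulrN. Qed.

Lemma sign_sign (T : pzRingType) (x : T) (a b : bool) :
  (-1) ^+ a * ((-1) ^+ b * x) = (-1) ^+ (a (+) b) * x.
Proof. by rewrite mulrA -signr_addb. Qed.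

Lemma sign_collect (T : pzRingType) (x y : T) (a b : bool) :
  (-1) ^+ a * ((-1) ^+ b * x * y) = (-1) ^+ (a (+) b) * (x * y).
Proof. by rewrite -mulrA mulrA -signr_addb. Qed.

Lemma qneg_neq n (i : qidx n) : (i == qneg i) = false.
Proof. by apply/negP => /eqP/(congr1 fst) /=; case: (i.1). Qed.

Lemma column_sign (T : pzRingType) (P Q : T) (e a b c : bool) : (e -> a = c) ->
  (-1) ^+ ((a (+) b) && (b (+) c))
    * ((if e then (-1) ^+ c * P else 0)
       - (-1) ^+ (((a (+) c) && (a (+) b)) (+) a) * Q)
  = (if e then (-1) ^+ b * P else 0) - (-1) ^+ b * Q.
Proof.
rewrite !mulr_sign; case: e => [-> //|_]; case: b; case: c;
  rewrite /= ?(opprB, oppr0, subr0, sub0r, opprK) // 1?addrC //; case: a;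
  by rewrite /= ?(opprB, oppr0, subr0, sub0r, opprK) // addrC.
Qed.

Section Pairs.
Variables (K : fieldType) (n : nat) (A : superAlgType K).
Hypothesis K2 : (2%:R : K) != 0.
Local Notation p := (@qpar n).
Local Notation B := (fps (fps A)).
Local Notation R := (Rser n A).
Local Notation pi S := (proj S : QEnd n (fps A)).
Implicit Types (S : {set 'I_n}) (X Y L M N : QEnd n (fps A)).
Implicit Types i j k m q : qidx n.

(** This notion covers both the leading corners of T and the single diagonal blocks H_a, so that all
    series in the induction come from the same construction. *)
Record corner_pair S X Y : Prop := CornerPair {
  pair_evenl : even X;
  pair_evenr : even Y;
  pair_pXl : pi S * X = X;
  pair_pXr : X * pi S = X;
  pair_pYl : pi S * Y = Y;
  pair_pYr : Y * pi S = Y;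
  pair_XY : X * Y = pi S;
  pair_YX : Y * X = pi S;
  pair_mixed : mixed S X Y
}.

Section OnePair.
Variables (S : {set 'I_n}) (X Y : QEnd n (fps A)) (XY : corner_pair S X Y).
Local Notation xx := (at_u X).
Local Notation yy := (at_v Y).

Lemma xx_even : even xx. Proof. exact: even_shom (at_u_shom _ _) (pair_evenl XY). Qed.
Lemma yy_even : even yy. Proof. exact: even_shom (at_v_shom _ _) (pair_evenr XY). Qed.

Lemma xx0 i j : (i.2 \notin S) || (j.2 \notin S) -> X (i, j) = 0.
Proof.
move=> H; rewrite -(pair_pXl XY) projM; case: ifP => // iS.
by rewrite -(pair_pXr XY) Mproj iS in H *; rewrite /= in H; rewrite (negPf H).
Qed.

Lemma yy0 i j : (i.2 \notin S) || (j.2 \notin S) -> Y (i, j) = 0.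
Proof.
move=> H; rewrite -(pair_pYl XY) projM; case: ifP => // iS.
by rewrite -(pair_pYr XY) Mproj iS in H *; rewrite /= in H; rewrite (negPf H).
Qed.

(** The supercommutator of x_im(u) and y_kq(v): [Ra] over [Rc] is the pole 1 / (u - v), [Rb] over
    [Rc] is 1 / (u + v). The conditions on indices are the entries of L = N = pi_S in
    [mixed_entry]. *)
Lemma pair_entry i m k q : i.2 \in S -> m.2 \in S -> k.2 \in S -> q.2 \in S ->
  Rc A * ((-1) ^+ ((p k (+) p q) && (p i (+) p m)) * (xx (i, m) * yy (k, q))
          - yy (k, q) * xx (i, m))
  = Ra A * ((if k == m then (-1) ^+ p m * (xx * yy) (i, q) else 0)
       - (if i == q then (-1) ^+ (((p k (+) p m) && (p k (+) p q)) (+) p k)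
                         * (yy * xx) (k, m) else 0))
  + Rb A * ((if k == qneg m then (-1) ^+ p m * (xx * smx_flip yy) (i, qneg q) else 0)
       - (if q == qneg i
          then (-1) ^+ (((p k (+) p m (+) true) && (p k (+) p q)) (+) p k (+) true)
               * (smx_flip yy * xx) (qneg k, m) else 0)).
Proof.
move=> iS mS kS qS.
have pp : pi S * pi S = pi S by rewrite proj_mul setIid.
have VY1 : V (pi S) * V Y = V Y by rewrite -(shomM (V_shom n A)) (pair_pYl XY).
have VY2 : V Y * V (pi S) = V Y by rewrite -(shomM (V_shom n A)) (pair_pYr XY).
have F1 : V (pi S) * U X * V Y = U X * V Y by exact: (absorbl (V_projC S X) VY1).
have F2 : V Y * U X * V (pi S) = V Y * U X by exact: (absorbr (V_projC S X) VY2).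
have E1 : (U X * V Y) (i, m) (k, q) = _ := tens12E yy i m k q xx_even.
have E2 : (V Y * U X) (i, m) (k, q) = _ := tens21E xx i m k q yy_even.
have eY : even (pi S * Y) by rewrite (pair_pYl XY); exact: (pair_evenr XY).
have := mixed_entry (pair_evenl XY) (proj_even _ S) (proj_even _ S) eY
  pp pp (pair_pYl XY) (pair_pYr XY) (pair_mixed XY) iS mS
  (etrans (congr1 (fun Z : QEnd n (QEnd n B) => Z (i, m) (k, q)) F1) E1)
  (etrans (congr1 (fun Z : QEnd n (QEnd n B) => Z (i, m) (k, q)) F2) E2).
move=> H; apply: (etrans H); rewrite {H} at_v_proj.
move: (xx * yy) (yy * xx) (xx * smx_flip yy) (smx_flip yy * xx) => P Q P' Q'.
rewrite !projE /= kS iS !andbT.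
congr (_ * (_ - _) + _ * (_ - _)).
- case: eqP => [->|_]; last by rewrite mul0r mulr0.
  by rewrite addbb andbF mul1r.
- by case: eqP => _; [rewrite mulr1|rewrite 2!mulr0].
- case: eqP => [->|_]; last by rewrite mul0r mulr0.
  by rewrite /qpar /=; case: (m.1); case: (q.1); rewrite /= mul1r.
- by rewrite [q == _]eq_sym; case: eqP => _; [rewrite mulr1|rewrite 2!mulr0].
Qed.

(* By column_diag this is sum_j x_jk y_kj for each k, hence Nazarov's z(u) when *)
(* X = T and Y = T^-1. *)
Definition zser X0 Y0 : fps A :=
  1 + \sum_i (-1) ^+ p i * (map_smx (@fps_deriv K A) X0 * Y0) (i, i).

Lemma xxE i j : xx (i, j) = in_u (X (i, j)). Proof. exact: ffunE. Qed.
Lemma yyE i j : yy (i, j) = in_v (Y (i, j)). Proof. exact: ffunE. Qed.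

Lemma ksign_in_u b (f : fps A) : ksign b (in_u f) = in_u (ksign b f).
Proof. by rewrite (shom_ksign (in_u_shom A)). Qed.
Lemma ksign_in_v b (f : fps A) : ksign b (in_v f) = in_v (ksign b f).
Proof. by rewrite (shom_ksign (in_v_shom A)). Qed.

Lemma at_uvE (Z W : QEnd n (fps A)) i j : (at_u Z * at_v W) (i, j)
  = \sum_k in_u (ksign (p k (+) p j) (Z (i, k))) * in_v (W (k, j)).
Proof. by rewrite smxME; apply: eq_bigr => k _; rewrite !ffunE ksign_in_u. Qed.

Lemma at_vuE (Z W : QEnd n (fps A)) i j : (at_v Z * at_u W) (i, j)
  = \sum_k in_v (ksign (p k (+) p j) (Z (i, k))) * in_u (W (k, j)).
Proof. by rewrite smxME; apply: eq_bigr => k _; rewrite !ffunE ksign_in_v. Qed.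

Lemma diag_at_uv (Z W : QEnd n (fps A)) i j :
  diag ((at_u Z * at_v W) (i, j)) = (Z * W) (i, j).
Proof.
have hd := diag_shom A.
rewrite at_uvE (shom_sum hd) smxME; apply: eq_bigr => k _.
by rewrite (shomM hd) diag_in_u diag_in_v.
Qed.

Lemma diag_at_vu (Z W : QEnd n (fps A)) i j :
  diag ((at_v Z * at_u W) (i, j)) = (Z * W) (i, j).
Proof.
have hd := diag_shom A.
rewrite at_vuE (shom_sum hd) smxME; apply: eq_bigr => k _.
by rewrite (shomM hd) diag_in_u diag_in_v.
Qed.

Lemma diag_deriv_at_uv (Z W : QEnd n (fps A)) i j :
  diag (fps_deriv ((at_u Z * at_v W) (i, j))) = (map_smx (@fps_deriv K A) Z * W) (i, j).
Proof.
rewrite at_uvE fps_deriv_sum (shom_sum (diag_shom A)) smxME; apply: eq_bigr => k _.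
by rewrite diag_deriv_uv fps_deriv_ksign [in RHS]ffunE.
Qed.

Lemma diag_deriv_at_vu (Z W : QEnd n (fps A)) i j :
  diag (fps_deriv ((at_v Z * at_u W) (i, j))) = (Z * map_smx (@fps_deriv K A) W) (i, j).
Proof.
rewrite at_vuE fps_deriv_sum (shom_sum (diag_shom A)) smxME; apply: eq_bigr => k _.
by rewrite diag_deriv_vu [in RHS]ffunE.
Qed.

(** This is str 1 = 0: j and -j lie in the same block and have opposite parities. Adding the sum to
    its reindexing by j -> -j gives 0, and 2 is invertible. *)
Lemma alt_sum (T : superAlgType K) (a : T) : \sum_(j : qidx n | j.2 \in S) (-1) ^+ p j * a = 0.
Proof.
apply: (mulr2n_eq0 K2); rewrite mulr2n {1}(reindex_inj (inv_inj (@qnegK n))) /=.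
rewrite -big_split big1 //= => j _; rewrite /qpar /=.
by rewrite !mulr_sign; case: (j.1); rewrite /= ?subrr ?addNr.
Qed.

Lemma diag_proj i j : diag ((yy * xx) (i, j)) = pi S (i, j).
Proof. by rewrite diag_at_vu (pair_YX XY). Qed.

Lemma diag_str : diag (\sum_(j | j.2 \in S) (-1) ^+ p j * (xx * yy) (j, j)) = 0.
Proof.
have hd := diag_shom A; rewrite (shom_sum hd) -[RHS](alt_sum (1 : fps A)).
apply: eq_bigr => j jS; by rewrite (shom_sign hd) diag_at_uv (pair_XY XY) projE eqxx jS.
Qed.

(** The last condition excludes exactly k = -m, the case in which the pole 1 / (u + v) would
    contribute. *)
Lemma column_sum k m : k.2 \in S -> m.2 \in S -> (k == m) || (k.2 != m.2) ->
  Rc A * (\sum_j xx (j, m) * yy (k, j) - (yy * xx) (k, m))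
  = Ra A * (if k == m then \sum_(j | j.2 \in S) (-1) ^+ p j * (xx * yy) (j, j) else 0)
    + Rb A * 0.
Proof.
move=> kS mS km.
have knm : (k == qneg m) = false.
  apply/negP => /eqP E; move: km; rewrite E /= eqxx orbF => /eqP/(congr1 fst) /=.
  by case: (m.1).
pose s j := (p k (+) p j) && (p j (+) p m).
pose G j := (-1) ^+ s j * (xx (j, m) * yy (k, j)) - yy (k, j) * xx (j, m).
have -> : \sum_j xx (j, m) * yy (k, j) - (yy * xx) (k, m)
    = \sum_(j | j.2 \in S) (-1) ^+ s j * G j.
  rewrite smxME -sumrB [RHS]big_mkcond; apply: eq_bigr => j _.
  case: ifP => jS; last first.
    by rewrite xxE yyE xx0 ?jS // (shom0 (in_u_shom A)) mul0r mulr0 subr0.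
  rewrite evenE; last exact: yy_even.
  rewrite /G mulrBr mulrA -signr_addb addbb mul1r; congr (_ - _).
  by rewrite mulrA /s andbC.
have EG j : j.2 \in S -> Rc A * ((-1) ^+ s j * G j) =
    Ra A * ((if k == m then (-1) ^+ p j * (xx * yy) (j, j) else 0)
            - (-1) ^+ p j * (yy * xx) (k, m)).
  move=> jS; have H := pair_entry jS mS kS jS.
  rewrite mul_signC H eqxx knm qneg_neq subrr mulr0 addr0 -mul_signC.
  congr (_ * _); apply: column_sign; by move/eqP->.
rewrite mulr_sumr (eq_bigr _ EG) mulr0 addr0 -mulr_sumr; congr (_ * _).
(* The term (Y X)_km does not depend on j, so the alternating sum removes it before v tends to u. *)
rewrite big_split /= sumrN alt_sum subr0; case: eqP => // _.
exact: big1.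
Qed.

(** For k = m the numerator left by [column_sum] is str X(u) Y(v), which is str pi_S = 0 at v = u;
    the limit is its derivative. For different blocks the numerator is 0, and so is the entry of Y X
    = pi_S. *)
Lemma column_diag k m : k.2 \in S -> m.2 \in S -> (k == m) || (k.2 != m.2) ->
  \sum_j X (j, m) * Y (k, j) = if k == m then zser X Y else 0.
Proof.
move=> kS mS km; have hd := diag_shom A.
have H := column_sum kS mS km.
have D0 : diag (if k == m then \sum_(j | j.2 \in S) (-1) ^+ p j * (xx * yy) (j, j)
                else 0) = 0.
  by case: eqP => _; [exact: diag_str|exact: (shom0 hd)].
have := diag_limit K2 H D0 (shom0 hd); rewrite (shomB hd) diag_proj (shom_sum hd).
rewrite projE kS andbT => /eqP; rewrite subr_eq => /eqP E.
transitivity (\sum_j diag (xx (j, m) * yy (k, j))).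
  by apply: eq_bigr => j _; rewrite (shomM hd) xxE yyE diag_in_u diag_in_v.
rewrite E; case: eqP => _; last by rewrite fps_deriv0 (shom0 hd) addr0.
rewrite addrC /zser fps_deriv_sum (shom_sum hd) big_mkcond; congr (_ + _).
apply: eq_bigr => j _; case: ifP => jS.
  by rewrite fps_deriv_sign (shom_sign hd) diag_deriv_at_uv.
by rewrite -(pair_pYr XY) mulrA Mproj jS mulr0.
Qed.

Lemma outer_zero i j : (i.2 \notin S) || (j.2 \notin S) -> (xx (i, j) = 0) * (yy (i, j) = 0).
Proof.
move=> H; rewrite xxE yyE xx0 // yy0 //.
by rewrite (shom0 (in_u_shom A)) (shom0 (in_v_shom A)).
Qed.

(** Both terms that [pair_entry] gives for x_ij and y_ji carry the sign of an index on which they do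
    not otherwise depend, so each double sum contains an alternating sum equal to 0. *)
Lemma str_swap :
  \sum_(i | i.2 \in S) (-1) ^+ p i * (xx * yy) (i, i)
  = \sum_(i | i.2 \in S) (-1) ^+ p i * (yy * xx) (i, i).
Proof.
have E1 : \sum_(i | i.2 \in S) (-1) ^+ p i * (xx * yy) (i, i)
    = \sum_(i | i.2 \in S) \sum_(j | j.2 \in S) (-1) ^+ p j * (xx (i, j) * yy (j, i)).
  apply: eq_bigr => i iS; rewrite smxME mulr_sumr [RHS]big_mkcond.
  apply: eq_bigr => j _; case: ifP => jS; last first.
    by rewrite outer_zero ?jS ?orbT // ksign0 mul0r mulr0.
  rewrite evenE; last exact: xx_even.
  rewrite sign_collect; congr (_ ^+ _ * _).
  by case: (p i); case: (p j).
have E2 : \sum_(i | i.2 \in S) (-1) ^+ p i * (yy * xx) (i, i)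
    = \sum_(i | i.2 \in S) \sum_(j | j.2 \in S) (-1) ^+ p i * (yy (j, i) * xx (i, j)).
  rewrite exchange_big.
  apply: eq_bigr => i iS; rewrite smxME mulr_sumr [RHS]big_mkcond.
  apply: eq_bigr => j _; case: ifP => jS; last first.
    by rewrite outer_zero ?jS ?orbT // ksign0 mul0r mulr0.
  rewrite evenE; last exact: yy_even.
  rewrite sign_collect; congr (_ ^+ _ * _).
  by case: (p i); case: (p j).
apply: (etrans E1); apply: (etrans _ (esym E2)) => {E1 E2}; apply: subr0_eq.
rewrite -sumrB; apply: in_uv_eq0.
change (in_v (fps_uinv A) ^+ 2 - in_u (fps_uinv A) ^+ 2) with (Rc A).
rewrite mulr_sumr.
pose P i := (-1) ^+ p i * (xx * yy) (i, i).
pose Q j := (yy * xx) (j, j).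
transitivity (\sum_(i | i.2 \in S) \sum_(j | j.2 \in S)
   Ra A * ((-1) ^+ p j * P i - (-1) ^+ p i * ((-1) ^+ p j * Q j))).
  apply: eq_bigr => i iS; rewrite -sumrB mulr_sumr; apply: eq_bigr => j jS.
  have H := pair_entry iS jS jS iS.
  rewrite !eqxx !qneg_neq subrr mulr0 addr0 addbb /= in H.
  have -> : (-1) ^+ p j * (xx (i, j) * yy (j, i)) - (-1) ^+ p i * (yy (j, i) * xx (i, j))
     = (-1) ^+ p i * ((-1) ^+ ((p j (+) p i) && (p i (+) p j)) * (xx (i, j) * yy (j, i))
          - yy (j, i) * xx (i, j)).
    rewrite mulrBr sign_sign; congr (_ ^+ _ * _ - _).
    by case: (p i); case: (p j).
  rewrite mul_signC H -mul_signC mulrBr; congr (_ * (_ - _)).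
  by rewrite /P -mul_signC.
rewrite (eq_bigr (fun i => - (Ra A * ((-1) ^+ p i * (\sum_(j | j.2 \in S) (-1) ^+ p j * Q j))))).
  rewrite sumrN -mulr_sumr.
  by rewrite alt_sum mulr0 oppr0.
move=> i iS; rewrite -mulr_sumr big_split /= alt_sum add0r sumrN -mulr_sumr.
by rewrite mulrN.
Qed.

(** Differentiate [str_swap] in u and set v := u. [commutator_sum] produces the supertrace in this
    order. *)
Lemma zserE : zser X Y = 1 + \sum_i (-1) ^+ p i * (Y * map_smx (@fps_deriv K A) X) (i, i).
Proof.
have hd := diag_shom A.
have dsum (F : qidx n -> B) : diag (fps_deriv (\sum_(i | i.2 \in S) F i))
    = \sum_(i | i.2 \in S) diag (fps_deriv (F i)).
  by rewrite fps_deriv_sum (shom_sum hd).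
have E := etrans (esym (dsum _)) (etrans (congr1 (fun f : B => diag (fps_deriv f)) str_swap) (dsum _)).
rewrite /zser; congr (_ + _).
transitivity (\sum_(i | i.2 \in S) diag (fps_deriv ((-1) ^+ p i * (xx * yy) (i, i)))).
  rewrite [RHS]big_mkcond; apply: eq_bigr => i _; case: ifP => iS.
    by rewrite fps_deriv_sign (shom_sign hd) diag_deriv_at_uv.
  by rewrite -(pair_pYr XY) mulrA Mproj iS mulr0.
apply: (etrans E); rewrite big_mkcond; apply: eq_bigr => i _; case: ifP => iS.
  by rewrite fps_deriv_sign (shom_sign hd) diag_deriv_at_vu.
by rewrite -(pair_pYl XY) -mulrA projM iS mulr0.
Qed.

(** This disposes of the pole 1 / (u + v) in [commutator_sum]. The supercommutators again cancel by
    alternating sums, so the order may be reversed; the result is sum_b (X(u) Y(v))_(b,-b), and at v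
    = u these are off-diagonal entries of pi_S. *)
Lemma flip_sum :
  diag (\sum_(a | a.2 \in S) \sum_(b | b.2 \in S) yy (a, qneg b) * xx (b, a)) = 0.
Proof.
have hd := diag_shom A.
suff -> : \sum_(a | a.2 \in S) \sum_(b | b.2 \in S) yy (a, qneg b) * xx (b, a)
   = \sum_(b | b.2 \in S) (xx * yy) (b, qneg b).
  rewrite (shom_sum hd) big1 // => b _.
  by rewrite diag_at_uv (pair_XY XY) projE qneg_neq.
have -> : \sum_(b | b.2 \in S) (xx * yy) (b, qneg b)
    = \sum_(a | a.2 \in S) \sum_(b | b.2 \in S) xx (b, a) * yy (a, qneg b).
  rewrite exchange_big; apply: eq_bigr => b bS; rewrite smxME [RHS]big_mkcond.
  apply: eq_bigr => a _; case: ifP => aS; last first.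
    by rewrite outer_zero ?aS ?orbT // ksign0 mul0r.
  rewrite evenE; last exact: xx_even.
  rewrite /qpar /=; case: (a.1); case: (b.1); by rewrite /= mul1r.
symmetry; apply: subr0_eq.
rewrite -sumrB; apply: in_uv_eq0.
change (in_v (fps_uinv A) ^+ 2 - in_u (fps_uinv A) ^+ 2) with (Rc A).
rewrite mulr_sumr.
transitivity (\sum_(a | a.2 \in S) \sum_(b | b.2 \in S)
   (Ra A * ((-1) ^+ p a * (xx * yy) (b, qneg b))
    - Rb A * ((-1) ^+ p b * (smx_flip yy * xx) (qneg a, a)))).
  apply: eq_bigr => a aS; rewrite -sumrB mulr_sumr; apply: eq_bigr => b bS.
  have qS : (qneg b).2 \in S by [].
  have H := pair_entry bS aS aS qS.
  rewrite !eqxx !qneg_neq subr0 sub0r mulrN in H.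
  have s1 : (p a (+) p (qneg b)) && (p b (+) p a) = false.
    by rewrite /qpar /=; case: (a.1); case: (b.1).
  have s2 : (p a (+) p a (+) true) && (p a (+) p (qneg b)) (+) p a (+) true = p b.
    by rewrite /qpar /=; case: (a.1); case: (b.1).
  by rewrite s1 s2 mul1r in H.
transitivity (\sum_(a | a.2 \in S) \sum_(b | b.2 \in S)
    Ra A * ((-1) ^+ p a * (xx * yy) (b, qneg b))
  - \sum_(a | a.2 \in S) \sum_(b | b.2 \in S)
    Rb A * ((-1) ^+ p b * (smx_flip yy * xx) (qneg a, a))).
  by rewrite -sumrB; apply: eq_bigr => a aS; rewrite -sumrB.
rewrite exchange_big [X in X - _]big1 => [|b bS]; last first.
  by rewrite -mulr_sumr alt_sum mulr0.
by rewrite sub0r big1 ?oppr0 // => a aS; rewrite -mulr_sumr alt_sum mulr0.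
Qed.

End OnePair.
End Pairs.

(** * Adjoining one diagonal block *)

Section Schur.
Variables (T : pzRingType) (r q X Y Y' h : T).
Hypotheses (rr : r * r = r) (rq : r * q = 0) (qr : q * r = 0) (qq : q * q = q).
Hypotheses (sX : (r + q) * X = X) (Xs : X * (r + q) = X).
Hypotheses (sY : (r + q) * Y = Y) (Ys : Y * (r + q) = Y).
Hypotheses (XY : X * Y = r + q) (YX : Y * X = r + q).
Hypotheses (qh : q * h = h) (hq : h * q = h).
Hypotheses (hD : h * (q * Y * q) = q) (Dh : q * Y * q * h = q).
Hypotheses (rY' : r * Y' = Y') (Y'r : Y' * r = Y') (X'Y' : r * X * r * Y' = r).

Local Notation e := (r * Y * h).

(* h is the inverse of the corner q Y q, and (r - e) Y the one of r X r. *)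
Lemma schur_hYq : h * Y * q = q.
Proof. by rewrite -[RHS]hD !mulrA hq. Qed.
Lemma schur_qYh : q * Y * h = q.
Proof. by rewrite -[RHS]Dh -!mulrA qh. Qed.
Lemma schur_hr : h * r = 0. Proof. by rewrite -hq -mulrA qr mulr0. Qed.
Lemma schur_rh : r * h = 0. Proof. by rewrite -qh mulrA rq mul0r. Qed.
Lemma schur_er : e * r = 0. Proof. by rewrite -mulrA schur_hr mulr0. Qed.
Lemma schur_re : r * e = e. Proof. by rewrite !mulrA rr. Qed.
Lemma schur_eq : e * q = e. Proof. by rewrite -mulrA hq. Qed.
Lemma schur_qe : q * e = 0. Proof. by rewrite !mulrA qr !mul0r. Qed.
Lemma schur_Yh : Y * h = e + q.
Proof. by rewrite -{1}sY !mulrDl schur_qYh. Qed.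
Lemma schur_XYh : X * (Y * h) = h.
Proof. by rewrite mulrA XY mulrDl schur_rh add0r qh. Qed.
Lemma schur_Ls : (r - e) * (r + q) = r - e.
Proof. by rewrite mulrDr !mulrBl rr rq schur_eq schur_er subr0 sub0r. Qed.
Lemma schur_sh : (r + q) * h = h.
Proof. by rewrite mulrDl schur_rh add0r qh. Qed.

Lemma schur_LYX : (r - e) * Y * X * r = r.
Proof.
by rewrite -(mulrA _ Y) YX schur_Ls mulrBl rr schur_er subr0.
Qed.

Lemma schur_LYr : (r - e) * Y * r = (r - e) * Y.
Proof.
have LYq : (r - e) * Y * q = 0.
  by rewrite !mulrBl -(mulrA (r * Y)) -(mulrA (r * Y)) schur_hYq subrr.
transitivity ((r - e) * (Y * (r + q))); last by rewrite Ys.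
by rewrite mulrA mulrDr LYq addr0.
Qed.

Lemma schur_LY : (r - e) * Y = Y'.
Proof.
transitivity ((r - e) * Y * (r * X * r * Y')).
  by rewrite X'Y' schur_LYr.
by rewrite 3!(mulrA ((r - e) * Y)) schur_LYr schur_LYX rY'.
Qed.

(** Here [ux] stands for a matrix in the other tensor factor. As e maps the Q-part to the P-part, e
    ux e = 0 and r ux q = 0, and only the commutator with e survives. *)
Lemma schur_commutator (ux : T) : GRing.comm r ux -> GRing.comm q ux ->
  (r - e) * ux * (e + q) = ux * e - e * ux.
Proof.
move=> ru qu.
have e2 : e * ux * q = e * ux by rewrite -mulrA -qu mulrA schur_eq.
have e1 : e * ux * e = 0 by rewrite -e2 -mulrA schur_qe mulr0.
have e3 : r * ux * e = ux * e by rewrite ru -mulrA schur_re.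
have e4 : r * ux * q = 0 by rewrite ru -mulrA rq mulr0.
by rewrite mulrDr !mulrBl e1 e2 e3 e4 subr0 sub0r.
Qed.

End Schur.

Lemma schur_outside (T : pzRingType) (r q y ux h : T) : GRing.comm r ux ->
  r * q = 0 -> y * r = y -> q * h = h -> y * ux * h = 0.
Proof.
move=> ru rq yr qh; have E : r * ux * q = 0 by rewrite ru -mulrA rq mulr0.
by rewrite -yr -qh mulrA -(mulrA y r) -(mulrA y) E mulr0 mul0r.
Qed.

Lemma alt_sum_sub (K : fieldType) n (T : superAlgType K) (S : {set 'I_n})
    (f : qidx n -> T) (M x : T) : (2%:R : K) != 0 ->
  \sum_(a | a.2 \in S) ((-1) ^+ qpar a * M - (-1) ^+ qpar a * (f a * x))
  = - ((\sum_(a | a.2 \in S) (-1) ^+ qpar a * f a) * x).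
Proof.
move=> K2; rewrite sumrB alt_sum // sub0r mulr_suml; congr (- _).
by apply: eq_bigr => a _; rewrite mulrA.
Qed.

Section Step.
Variables (K : fieldType) (n : nat) (A : superAlgType K).
Hypothesis K2 : (2%:R : K) != 0.
Local Notation p := (@qpar n).
Local Notation B := (fps (fps A)).
Local Notation pi S := (proj S : QEnd n (fps A)).
Implicit Types i j k m : qidx n.

Variables (S P Q : {set 'I_n}) (X Y Y' h : QEnd n (fps A)).
Hypotheses (SPQ : S = P :|: Q) (PQ : P :&: Q = set0).
Hypotheses (XY : corner_pair S X Y) (XY' : corner_pair P (pi P * X * pi P) Y').
Hypothesis hY : corner_pair Q h (pi Q * Y * pi Q).

Local Notation e := (pi P * Y * h).
Local Notation L := (pi P - e).

Lemma proj0 : pi set0 = 0.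
Proof. by apply/ffunP => -[i j]; rewrite projE inE andbF smx0E. Qed.

Lemma projU : pi S = pi P + pi Q.
Proof.
apply/ffunP => -[i j]; rewrite smxDE !projE SPQ inE.
have : (i.2 \in P) && (i.2 \in Q) = false by rewrite -in_setI PQ inE.
by case: (i == j); case: (i.2 \in P); case: (i.2 \in Q) => //=; rewrite ?addr0 ?add0r.
Qed.

Let rr : pi P * pi P = pi P. Proof. by rewrite proj_mul setIid. Qed.
Let qq : pi Q * pi Q = pi Q. Proof. by rewrite proj_mul setIid. Qed.
Let rq : pi P * pi Q = 0. Proof. by rewrite proj_mul PQ proj0. Qed.
Let qr : pi Q * pi P = 0. Proof. by rewrite proj_mul setIC PQ proj0. Qed.
Let PS i : i.2 \in P -> i.2 \in S. Proof. by rewrite SPQ inE => ->. Qed.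
Let QS i : i.2 \in Q -> i.2 \in S. Proof. by rewrite SPQ inE orbC => ->. Qed.
Let PnQ i : i.2 \in P -> (i.2 \in Q) = false.
Proof.
move=> iP; apply/negP => iQ.
by have : i.2 \in P :&: Q; [rewrite inE iP|rewrite PQ inE].
Qed.
Let sY : (pi P + pi Q) * Y = Y. Proof. by rewrite -projU (pair_pYl XY). Qed.
Let Ys : Y * (pi P + pi Q) = Y. Proof. by rewrite -projU (pair_pYr XY). Qed.
Let XYs : X * Y = pi P + pi Q. Proof. by rewrite -projU (pair_XY XY). Qed.
Let YXs : Y * X = pi P + pi Q. Proof. by rewrite -projU (pair_YX XY). Qed.
Let qh := pair_pXl hY.
Let hq := pair_pXr hY.
Let hD := pair_XY hY.
Let Dh := pair_YX hY.
Let rY' := pair_pYl XY'.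
Let Y'r := pair_pYr XY'.

Lemma LY_E : L * Y = Y'.
Proof. exact: (schur_LY rr rq qr Ys YXs hq hD rY' (pair_XY XY')). Qed.

(** Use [mixed_entry] with L = pi_P - e and N = h. Then Y h = e + pi_Q and L Y = Y', so one side
    becomes the commutator of X and e, and Y' X h vanishes. Summed over a in P, the first pole
    leaves str (Y'(v) X(u)) h(v), whose limit brings in the derivative counted by z' - 1. *)
Lemma commutator_sum j k : j.2 \in S -> k.2 \in Q ->
  \sum_(a | a.2 \in P) ((-1) ^+ ((p a (+) p k) && (p j (+) p a)) * (X (j, a) * e (a, k))
                         - e (a, k) * X (j, a))
  = - (zser (pi P * X * pi P) Y' - 1) * h (j, k).
Proof.
move=> jS kQ.
have hU := U_shom n A; have hV := V_shom n A.
have E a : a.2 \in P ->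
  Rc A * ((-1) ^+ ((p a (+) p k) && (p j (+) p a)) * (at_u X (j, a) * at_v e (a, k))
        - at_v e (a, k) * at_u X (j, a))
  = Ra A * ((-1) ^+ p a * (at_u X * at_v (Y * h)) (j, k)
      - (-1) ^+ p a * ((at_v Y' * at_u X) (a, a) * at_v h (j, k)))
   + Rb A * (- ((-1) ^+ (~~ p k) * ((smx_flip (at_v Y') * at_u X) (qneg a, a)
      * at_v h (qneg j, k)))).
  move=> aP.
  have aS : a.2 \in S by exact: PS.
  have eX := pair_evenl XY; have eh := pair_evenl hY.
  have ee : even e by apply: evenM => //; apply: evenM; [exact: proj_even|exact: pair_evenr XY].
  have eL : even L by apply: evenB; [exact: proj_even|exact: ee].
  have eLY : even (L * Y) by rewrite LY_E; exact: pair_evenr XY'.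
  have Ls : L * pi S = L by rewrite projU; exact: (schur_Ls Y rr rq qr hq).
  have sh : pi S * h = h by rewrite projU; exact: (schur_sh rq qh).
  have F1 : V L * U X * V (Y * h) = U X * V e - V e * U X.
    have VM Z W : V (Z * W) = V Z * V W := shomM hV Z W.
    rewrite (schur_Yh sY qh Dh) (shomB hV) (shomD hV) !VM.
    have v1 : V (pi P) * V (pi P) = V (pi P) by rewrite -VM rr.
    have v2 : V (pi P) * V (pi Q) = 0 by rewrite -VM rq (shom0 hV).
    have v3 : V (pi Q) * V (pi P) = 0 by rewrite -VM qr (shom0 hV).
    have v4 : V h * V (pi Q) = V h by rewrite -VM hq.
    exact: (schur_commutator (V Y) v1 v2 v3 v4 (V_projC P X) (V_projC Q X)).
  have F2 : V Y' * U X * V h = 0.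
    apply: (schur_outside (V_projC P X) (q := V (pi Q))).
    - by rewrite -(shomM hV) rq (shom0 hV).
    - by rewrite -(shomM hV) Y'r.
    - by rewrite -(shomM hV) qh.
  have G1 : (V L * U X * V (Y * h)) (j, a) (a, k)
      = (-1) ^+ ((p a (+) p k) && (p j (+) p a)) * (at_u X (j, a) * at_v e (a, k))
        - at_v e (a, k) * at_u X (j, a).
    rewrite F1; have hu := even_shom (at_u_shom n A) eX.
    have hv := even_shom (at_v_shom n A) ee.
    have E1 := tens12E (at_v e) j a a k hu; have E2 := tens21E (at_u X) j a a k hv.
    by rewrite -[in RHS]E1 -[in RHS]E2 !smxDE !smxNE.
  have G2 : (V Y' * U X * V h) (j, a) (a, k) = 0 by rewrite F2 !smx0E.
  have H := mixed_entry eX eL eh eLY Ls sh LY_E erefl (pair_mixed XY) jS aS G1 G2.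
  (* The columns of e lie in Q, so on columns in P the matrix L is the identity. *)
  have LE i : i.2 \in P -> at_v L (a, i) = if a == i then 1 else 0.
    move=> iP; rewrite ffunE smxDE smxNE projE aP andbT.
    have -> : e (a, i) = 0 by rewrite -hq mulrA Mproj PnQ.
    by rewrite subr0; case: eqP => _; rewrite ?(shom1 (in_v_shom A)) ?(shom0 (in_v_shom A)).
  have L1 : at_v L (a, a) = 1 by rewrite LE ?eqxx.
  have L0 : at_v L (a, qneg a) = 0 by rewrite LE ?qneg_neq.
  apply: (etrans _ (etrans H _)); first by rewrite [in RHS]subr0.
  rewrite L1 L0 mul1r mul0r mulr0 sub0r !addbb andbF /=.
  by congr (_ + _ * - (_ ^+ _ * _)); case: (p a); case: (p k).
have hd := diag_shom A.
pose W := \sum_(a | a.2 \in P) (-1) ^+ p a * (at_v Y' * at_u X) (a, a).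
pose O := \sum_(a | a.2 \in P) (smx_flip (at_v Y') * at_u X) (qneg a, a).
pose C := \sum_(a | a.2 \in P)
  ((-1) ^+ ((p a (+) p k) && (p j (+) p a)) * (at_u X (j, a) * at_v e (a, k))
        - at_v e (a, k) * at_u X (j, a)).
have HC : Rc A * C = Ra A * - (W * at_v h (j, k))
    + Rb A * - ((-1) ^+ (~~ p k) * (O * at_v h (qneg j, k))).
  rewrite mulr_sumr (eq_bigr _ E) big_split /= -!mulr_sumr; congr (_ * _ + _ * _).
    exact: alt_sum_sub.
  rewrite sumrN -mulr_sumr; congr (- (_ * _)).
  by rewrite /O mulr_suml.
(* At v = u, Y' X is the identity on P because Y' = L Y and Y X = pi_S; hence W becomes str pi_P. *)
have W0 : diag W = 0.
  rewrite (shom_sum hd) -[RHS](alt_sum K2 P (1 : fps A)); apply: eq_bigr => a aP.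
  rewrite (shom_sign hd) diag_at_vu; congr (_ * _).
  rewrite -[LHS]/(if true then _ else 0) -aP -Mproj -LY_E.
  by rewrite (schur_LYX rr rq qr YXs hq) projE eqxx aP.
have rXr b a : b.2 \in P -> a.2 \in P -> (pi P * X * pi P) (b, a) = X (b, a).
  by move=> bP aP; rewrite Mproj aP projM bP.
have Y'0 a b : b.2 \notin P -> Y' (a, b) = 0.
  by move=> bP; rewrite -Y'r Mproj (negPf bP).
have O0 : diag O = 0.
  rewrite -(flip_sum K2 XY'); congr diag; apply: eq_bigr => a aP.
  rewrite smxME [RHS]big_mkcond; apply: eq_bigr => b _; case: ifP => bP.
    rewrite [smx_flip _ _]ffunE /= qnegK evenE; last first.
      exact: even_shom (at_v_shom n A) (pair_evenr XY').
    rewrite [at_u (_ * _) _]ffunE rXr // [at_u X _]ffunE.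
    by congr (_ * _); rewrite /qpar /=; case: (a.1); case: (b.1); rewrite /= mul1r.
  rewrite [smx_flip _ _]ffunE /= [at_v _ _]ffunE Y'0 /= ?bP //.
  by rewrite (shom0 (in_v_shom A)) ksign0 mul0r.
(* The columns of Y' lie in P, so this supertrace involves only the P-corner of X. *)
have HW : diag (fps_deriv W) = zser (pi P * X * pi P) Y' - 1.
  rewrite (zserE K2 XY') addrAC subrr add0r fps_deriv_sum (shom_sum hd).
  rewrite big_mkcond; apply: eq_bigr => a _; case: ifP => aP.
    rewrite fps_deriv_sign (shom_sign hd) diag_deriv_at_vu; congr (_ * _).
    rewrite !smxME; apply: eq_bigr => b _; case bP: (b.2 \in P).
      by rewrite [map_smx _ _ _]ffunE [in RHS]ffunE rXr.
    by rewrite Y'0 ?bP // ksign0 !mul0r.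
  by rewrite -Y'r -{1}rY' -!mulrA projM aP mulr0.
have D0 : diag (- (W * at_v h (j, k))) = 0.
  by rewrite (shomN hd) (shomM hd) W0 mul0r oppr0.
have E0 : diag (- ((-1) ^+ (~~ p k) * (O * at_v h (qneg j, k)))) = 0.
  by rewrite (shomN hd) (shom_sign hd) (shomM hd) O0 mul0r mulr0 oppr0.
have HL := diag_limit K2 HC D0 E0.
have vE (Z : QEnd n (fps A)) i i' : at_v Z (i, i') = in_v (Z (i, i')) by apply: ffunE.
have uE (Z : QEnd n (fps A)) i i' : at_u Z (i, i') = in_u (Z (i, i')) by apply: ffunE.
transitivity (diag C).
  rewrite (shom_sum hd); apply: eq_bigr => a _.
  by rewrite (shomB hd) (shom_sign hd) !(shomM hd) vE uE diag_in_u diag_in_v.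
apply: (etrans HL); rewrite fps_derivN (shomN hd) fps_derivM (shomD hd) !(shomM hd).
rewrite vE fps_deriv_const (shom0 hd) mulr0 addr0 diag_in_v HW.
by rewrite mulNr.
Qed.

(** The point is that x_jk = z' h_jk - sum_a e_ak x_ja for k in Q. Multiplying by y_kj on the right
    and summing over j leaves z' times the column sum of h. *)
Lemma zser_step k : k.2 \in Q ->
  zser X Y = zser (pi P * X * pi P) Y' * zser h (pi Q * Y * pi Q).
Proof.
move=> kQ; set z' := zser (_ * X * _) _.
have kS : k.2 \in S by apply: QS.
have C1 := column_diag K2 XY kS kS; rewrite !eqxx orTb in C1; rewrite -C1 // => {C1}.
have C2 := column_diag K2 hY kQ kQ; rewrite !eqxx orTb in C2.
have {}C2 : \sum_j h (j, k) * Y (k, j) = zser h (pi Q * Y * pi Q).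
  rewrite -C2 //; apply: eq_bigr => j _; rewrite Mproj projM kQ; case: ifP => // jQ.
  by rewrite -qh projM jQ !mul0r.
pose g j a := (-1) ^+ ((p a (+) p k) && (p j (+) p a)) * (X (j, a) * e (a, k)).
(* Column k of X (e + pi_Q) = X Y h = h. *)
have Xjk j : X (j, k) = h (j, k) - \sum_(a | a.2 \in P) g j a.
  apply/eqP; rewrite eq_sym subr_eq addrC; apply/eqP.
  rewrite -{1}(schur_XYh rq XYs qh) (schur_Yh sY qh Dh) mulrDr smxDE Mproj kQ.
  congr (_ + _); rewrite smxME [RHS]big_mkcond; apply: eq_bigr => a _; case: ifP => aP.
    by rewrite evenE; [rewrite /g mulrA|exact: pair_evenl XY].
  by rewrite -[e](schur_re Y h rr) projM aP mulr0.
(* Moving e to the left of X by [commutator_sum] adds (z' - 1) h. *)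
transitivity (\sum_j (h (j, k) + (z' - 1) * h (j, k)) * Y (k, j)
    - \sum_j (\sum_(a | a.2 \in P) e (a, k) * X (j, a)) * Y (k, j)).
  rewrite -sumrB; apply: eq_bigr => j _; rewrite -mulrBl; case jS: (j.2 \in S).
    rewrite Xjk -[(z' - 1) * _]opprK -mulNr -(commutator_sum jS kQ) sumrB.
    by congr (_ * _); rewrite opprB addrA addrAC addrK.
  by rewrite -(pair_pYr XY) Mproj jS !mulr0.
(* With e_ak factored out on the left, the sum over j is an off-diagonal [column_diag]: a in P and k
   in Q belong to different blocks. *)
have -> : \sum_j (\sum_(a | a.2 \in P) e (a, k) * X (j, a)) * Y (k, j) = 0.
  under eq_bigr => j _ do rewrite mulr_suml.
  rewrite exchange_big big1 // => a aP /=.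
  under eq_bigr => j _ do rewrite -mulrA.
  rewrite -mulr_sumr (column_diag K2 XY kS (PS aP)).
    case: eqP => [E|_]; last by rewrite mulr0.
    by have := PnQ aP; rewrite -E kQ.
  by apply/orP; right; apply/eqP => E; have := PnQ aP; rewrite -E kQ.
rewrite subr0 -C2 mulr_sumr; apply: eq_bigr => j _.
by rewrite mulrA; congr (_ * _); rewrite mulrBl mul1r addrC subrK.
Qed.

End Step.

(** * The ternary relation under passage to corners and inverses *)

Lemma corner_relation (T : pzRingType) (r a b up vp : T) :
  r * a * b = b * a * r -> up * vp * r = r * (up * vp) ->
  GRing.comm up vp -> GRing.comm up b -> GRing.comm vp a ->
  r * (up * a * up) * (vp * b * vp) = (vp * b * vp) * (up * a * up) * r.
Proof.
move=> E R uv ub va.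
have E1 : up * a * up * (vp * b * vp) = up * vp * (a * b) * (up * vp).
  transitivity (up * (a * (vp * up) * b) * vp); first by rewrite -uv !mulrA.
  transitivity (up * (vp * a) * (b * up) * vp); first by rewrite va -ub !mulrA.
  by rewrite !mulrA.
have E2 : vp * b * vp * (up * a * up) = up * vp * (b * a) * (up * vp).
  transitivity (vp * (b * (up * vp) * a) * up); first by rewrite uv !mulrA.
  transitivity (vp * (up * b) * (a * vp) * up); first by rewrite ub -va !mulrA.
  by rewrite uv -!mulrA -uv.
rewrite -mulrA E1 E2 -!(mulrA (up * vp)) mulrA -R -mulrA (mulrA r) (mulrA r) E.
by rewrite -!(mulrA (b * a)) R !mulrA.
Qed.

(** Multiply the ternary relation on both sides by the inverse in the second factor. [mixed_right]
    starts from the opposite relation and uses the inverse in the first. *)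
Lemma mixed_left (T : pzRingType) (r ua va vb up vp : T) :
  r * ua * va = va * ua * r -> va * vb = vp -> vb * va = vp ->
  up * ua = ua -> ua * up = ua -> GRing.comm up vp ->
  vp * (ua * r * vb) * up = up * (vb * r * ua) * vp.
Proof.
move=> E ab ba upa uap uv.
have {E} E : vb * r * ua * vp = vp * ua * r * vb.
  have : vb * (r * ua * va) * vb = vb * (va * ua * r) * vb by rewrite E.
  by rewrite !mulrA ba -(mulrA _ va vb) ab.
transitivity (up * (vp * ua * r * vb) * up).
  by rewrite !mulrA uv -(mulrA vp up) upa.
by rewrite -E -!mulrA -uv (mulrA ua) uap.
Qed.

Lemma mixed_right (T : pzRingType) (r vd ud uh up vp : T) :
  r * vd * ud = ud * vd * r -> ud * uh = up -> uh * ud = up ->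
  vp * vd = vd -> vd * vp = vd -> GRing.comm up vp ->
  vp * (uh * r * vd) * up = up * (vd * r * uh) * vp.
Proof.
move=> E dh hd vpd vdp uv.
have {E} E : uh * r * vd * up = up * vd * r * uh.
  have : uh * (r * vd * ud) * uh = uh * (ud * vd * r) * uh by rewrite E.
  by rewrite !mulrA hd -(mulrA _ ud uh) dh.
transitivity (vp * (uh * r * vd * up) * vp).
  by rewrite !mulrA -(mulrA _ up vp) uv mulrA -(mulrA _ vd vp) vdp.
by rewrite E !mulrA -uv -(mulrA up vp) vpd.
Qed.

(** Multiply by [ub * vb] on the left and [vb * ub] on the right. The inverses cancel only up to
    projections, which are moved through r as the pair [up * vp] and then absorbed. *)
Lemma inverse_relation (T : pzRingType) (r ua va ub vb up vp : T) :
  r * ua * va = va * ua * r -> up * vp * r = r * (up * vp) ->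
  va * vb = vp -> vb * va = vp -> ua * ub = up -> ub * ua = up ->
  GRing.comm up vb -> GRing.comm vp ua -> GRing.comm vp ub -> GRing.comm up vp ->
  ub * up = ub -> vb * vp = vb -> up * ub = ub -> vp * vb = vb ->
  r * vb * ub = ub * vb * r.
Proof.
move=> E R vab vba uab uba uvb vua vub uv ubp vbp upb vpb.
have L : ub * vb * (r * ua * va) * (vb * ub) = ub * vb * r.
  transitivity (ub * vb * (r * (ua * (va * vb) * ub))); first by rewrite !mulrA.
  rewrite vab -vua -(mulrA vp) uab -uv -R !mulrA -(mulrA ub vb) -uvb.
  by rewrite !mulrA ubp -(mulrA ub vb vp) vbp.
have M : ub * vb * (va * ua * r) * (vb * ub) = r * (vb * ub).
  transitivity (ub * (vb * va) * ua * r * (vb * ub)); first by rewrite !mulrA.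
  rewrite vba -vub -(mulrA vp) uba -uv R -!mulrA (mulrA vp) vpb.
  by rewrite (mulrA up) uvb -(mulrA vb) upb.
by rewrite -mulrA -M -E L.
Qed.

(** The inverse is the finite geometric series in -x. Every power of x respects the projections that
    x respects, so inverses of triangular matrices stay triangular. *)
Lemma unipotent_inverse (T : pzRingType) (x : T) (N : nat) : x ^+ N = 0 ->
  exists y : T, [/\ (1 + x) * y = 1, y * (1 + x) = 1,
    forall e, x * e = e * x * e -> e * e = e -> y * e = e * y * e &
    forall e, e * x = e * x * e -> e * e = e -> e * y = e * y * e].
Proof.
move=> xN; pose y := \sum_(i < N) (- x) ^+ i.
have yx : (1 + x) * y = 1.
  have := subrX1 (- x) N; rewrite exprNn xN mulr0 sub0r => /(congr1 -%R).
  by rewrite opprK -mulNr opprB opprK => <-.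
have xy : GRing.comm x y.
  by apply: commr_sum => i _; apply: commrX; apply: commrN.
have xe z e i : z * e = e * z * e -> e * e = e -> z ^+ i * e = e * z ^+ i * e.
  move=> E ee; elim: i => [|i IH]; first by rewrite mulr1 mul1r ee.
  by rewrite exprSr -mulrA E !mulrA IH -!mulrA (mulrA e z) -E.
have ex z e i : e * z = e * z * e -> e * e = e -> e * z ^+ i = e * z ^+ i * e.
  move=> E ee; elim: i => [|i IH]; first by rewrite mulr1 ee.
  by rewrite exprS mulrA E -mulrA IH !mulrA -(mulrA _ e e) ee.
exists y; split=> //.
- transitivity ((1 + x) * y) => //; apply: commrD; first exact: commr1.
  exact: commr_sym.
- move=> e E ee; rewrite mulr_suml mulr_sumr mulr_suml; apply: eq_bigr => i _.
  by apply: xe; rewrite // mulNr mulrN mulNr -E.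
- move=> e E ee; rewrite mulr_sumr mulr_suml; apply: eq_bigr => i _.
  by apply: ex; rewrite // mulrN mulNr -E.
Qed.

(** * Corners of the Gauss decomposition *)

Section Flatten.
Variables (K : fieldType) (n : nat) (A : superAlgType K).
Implicit Types M N : 'M[End11 A]_n.

Lemma sum_qidx (F : qidx n -> A) : \sum_i F i = \sum_b \sum_a F (b, a).
Proof. by rewrite pair_bigA; apply: eq_bigr => -[]. Qed.

Definition flatten_mx M : QEnd n A :=
  [ffun ij => M ij.1.2 ij.2.2 (ij.1.1, ij.2.1)].

Lemma flatten_mxE M i j : flatten_mx M (i, j) = M i.2 j.2 (i.1, j.1).
Proof. exact: ffunE. Qed.

Lemma flatten_mxM M N : flatten_mx (M *m N) = flatten_mx M * flatten_mx N.
Proof.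
apply/ffunP => -[[b a] [b' a']]; rewrite flatten_mxE smxME mxE /=.
rewrite smx_sumE sum_qidx exchange_big; apply: eq_bigr => d _.
by rewrite smxME; apply: eq_bigr => c _; rewrite !flatten_mxE.
Qed.

Lemma flatten_mx1 : flatten_mx 1%:M = 1.
Proof.
apply/ffunP => -[[b a] [b' a']]; rewrite flatten_mxE mxE smx1E xpair_eqE /=.
by case: (a == a'); rewrite ?andbT ?andbF mulrb ?smx1E ?smx0E.
Qed.

Lemma flatten_diag_mul (H G : 'I_n -> End11 A) :
  flatten_mx (diag_mx (\row_a H a)) * flatten_mx (diag_mx (\row_a G a))
  = flatten_mx (diag_mx (\row_a (H a * G a))).
Proof.
rewrite -flatten_mxM mulmx_diag; congr (flatten_mx (diag_mx _)).
by apply/rowP => a; rewrite !mxE.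
Qed.

End Flatten.

Section Initial.
Variables (K : fieldType) (n : nat) (A : superAlgType K).

Definition below (m : nat) : {set 'I_n} := [set a : 'I_n | (a < m)%N].

Local Notation pim m := (proj (below m) : QEnd n A).

Lemma below_n : pim n = 1.
Proof. by apply/ffunP => -[i j]; rewrite projE inE ltn_ord andbT smx1E. Qed.

Lemma below_0 : pim 0 = 0.
Proof. by apply/ffunP => -[i j]; rewrite projE inE andbF smx0E. Qed.

(** Each factor x lowers the index of the projection to its left by one, down to the empty
    corner. *)
Lemma strictly_lower_nilpotent (x : QEnd n A) :
  (forall m, pim m.+1 * x = pim m.+1 * x * pim m) -> x ^+ n = 0.
Proof.
move=> E; suff H m : pim m * x ^+ m = 0 by rewrite -[LHS]mul1r -below_n H.
elim: m => [|m IH]; first by rewrite below_0 mul0r.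
by rewrite exprS mulrA E -mulrA IH mulr0.
Qed.

Lemma strictly_upper_nilpotent (x : QEnd n A) :
  (forall m, x * pim m.+1 = pim m * x * pim m.+1) -> x ^+ n = 0.
Proof.
move=> E; suff H m : x ^+ m * pim m = 0 by rewrite -[LHS]mulr1 -below_n H.
elim: m => [|m IH]; first by rewrite below_0 mulr0.
by rewrite exprSr -mulrA E !mulrA IH !mul0r.
Qed.

Lemma lower_corner (M : QEnd n A) :
  (forall i j : qidx n, (i.2 < j.2)%N -> M (i, j) = 0) ->
  forall m, pim m * M = pim m * M * pim m.
Proof.
move=> H m; apply/ffunP => -[i j]; rewrite Mproj projM !inE.
case: (ltnP i.2 _) => im; case: (ltnP j.2 m) => mj //.
by apply: H; exact: leq_trans im mj.
Qed.

Lemma strictly_lower_corner (M : QEnd n A) :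
  (forall i j : qidx n, (i.2 <= j.2)%N -> M (i, j) = 0) ->
  forall m, pim m.+1 * M = pim m.+1 * M * pim m.
Proof.
move=> H m; apply/ffunP => -[i j]; rewrite Mproj projM !inE.
case: (ltnP i.2 _) => im; case: (ltnP j.2 m) => mj //.
by apply: H; apply: leq_trans mj; rewrite -ltnS.
Qed.

Lemma upper_corner (M : QEnd n A) :
  (forall i j : qidx n, (j.2 < i.2)%N -> M (i, j) = 0) ->
  forall m, M * pim m = pim m * M * pim m.
Proof.
move=> H m; apply/ffunP => -[i j]; rewrite !Mproj projM !inE.
case: (ltnP j.2 _) => jm; case: (ltnP i.2 m) => mi //.
by apply: H; exact: leq_trans jm mi.
Qed.

Lemma strictly_upper_corner (M : QEnd n A) :
  (forall i j : qidx n, (j.2 <= i.2)%N -> M (i, j) = 0) ->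
  forall m, M * pim m.+1 = pim m * M * pim m.+1.
Proof.
move=> H m; apply/ffunP => -[i j]; rewrite !Mproj projM !inE.
case: (ltnP j.2 _) => jm; case: (ltnP i.2 m) => mi //.
by apply: H; apply: leq_trans mi; rewrite -ltnS.
Qed.

Lemma proj_diagC (S : {set 'I_n}) (H : 'I_n -> End11 A) :
  GRing.comm (proj S) (flatten_mx (diag_mx (\row_a H a))).
Proof.
apply/ffunP => -[i j]; rewrite projM Mproj flatten_mxE !mxE.
by case: eqP => [->|_] //; rewrite !mulr0n smx0E !if_same.
Qed.

End Initial.

(** With y_0 the even part of y: y_0 = e y_0 = y x y_0 = y (x y)_0 = y e = y. *)
Lemma even_corner_inverse (K : fieldType) (A : superAlgType K) (e x y : A) :
  even e -> even x -> x * y = e -> y * x = e -> e * y = y -> y * e = y -> even y.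
Proof.
move=> ee ex xy yx ey ye.
have evl (a b : A) : even a -> hpart false (a * b) = a * hpart false b.
  move=> ea; rewrite -{1}[b]hpart_sum mulrDr hpartD.
  have -> : hpart false (a * hpart true b) = 0.
    by rewrite -{1}ea -(hpart_mul false true) hpart_proj.
  by rewrite addr0 -{1}ea (hpart_mul false false) ea.
by rewrite /even -[in LHS]ey evl // -yx -mulrA -evl // xy ee ye.
Qed.

Section Rtt.
Variables (K : fieldType) (n : nat) (A : superAlgType K).
Local Notation R := (Rser n A).
Local Notation pi S := (proj S : QEnd n (fps A)).
Implicit Types (S : {set 'I_n}) (X Y : QEnd n (fps A)).

Definition rtt X := R * U X * V X = V X * U X * R.
Definition rtt_op X := R * V X * U X = U X * V X * R.

Let UM X Y : U (X * Y) = U X * U Y := shomM (U_shom n A) X Y.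
Let VM X Y : V (X * Y) = V X * V Y := shomM (V_shom n A) X Y.

Lemma UVC S : GRing.comm (U (pi S)) (V (pi S)). Proof. exact: U_projC. Qed.
Lemma UVR S : U (pi S) * V (pi S) * R = R * (U (pi S) * V (pi S)).
Proof. exact: UV_R. Qed.
Lemma VUR S : V (pi S) * U (pi S) * R = R * (V (pi S) * U (pi S)).
Proof.
have E : V (pi S) * U (pi S) = U (pi S) * V (pi S) by symmetry; exact: UVC.
by rewrite E; exact: UVR.
Qed.

Lemma rtt_corner S X : rtt X -> rtt (pi S * X * pi S).
Proof.
move=> H; rewrite /rtt !UM !VM.
exact: (corner_relation H (UVR S) (UVC S) (U_projC S X) (V_projC S X)).
Qed.

Lemma rtt_op_corner S X : rtt_op X -> rtt_op (pi S * X * pi S).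
Proof.
move=> H; rewrite /rtt_op !UM !VM.
exact: (corner_relation H (VUR S) (commr_sym (UVC S)) (V_projC S X) (U_projC S X)).
Qed.

Section Inverse.
Variables (S : {set 'I_n}) (X Y : QEnd n (fps A)).
Hypotheses (XY : X * Y = pi S) (YX : Y * X = pi S).
Hypotheses (sX : pi S * X = X) (Xs : X * pi S = X).
Hypotheses (sY : pi S * Y = Y) (Ys : Y * pi S = Y).

Lemma rtt_inverse : rtt X -> rtt_op Y.
Proof.
move=> H.
apply: (inverse_relation H (UVR S) _ _ _ _ (U_projC S Y) (V_projC S X) (V_projC S Y) (UVC S)).
- by rewrite -VM XY.
- by rewrite -VM YX.
- by rewrite -UM XY.
- by rewrite -UM YX.
- by rewrite -UM Ys.
- by rewrite -VM Ys.
- by rewrite -UM sY.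
- by rewrite -VM sY.
Qed.

Lemma rtt_pair : even X -> rtt X -> corner_pair S X Y.
Proof.
move=> eX H; have eY := even_corner_inverse (proj_even _ S) eX XY YX sY Ys.
apply: (CornerPair eX eY sX Xs sY Ys XY YX).
apply: (mixed_left H _ _ _ _ (UVC S)).
- by rewrite -VM XY.
- by rewrite -VM YX.
- by rewrite -UM sX.
- by rewrite -UM Xs.
Qed.

Lemma rtt_op_pair : even Y -> rtt_op Y -> corner_pair S X Y.
Proof.
move=> eY H; have eX := even_corner_inverse (proj_even _ S) eY YX XY sX Xs.
apply: (CornerPair eX eY sX Xs sY Ys XY YX).
apply: (mixed_right H _ _ _ _ (UVC S)).
- by rewrite -UM YX.
- by rewrite -UM XY.
- by rewrite -VM sY.
- by rewrite -VM Ys.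
Qed.

End Inverse.
End Rtt.

Section GaussCorner.
Variables (T : pzRingType) (e F Fi H Hi E Ei : T).
Hypotheses (ee : e * e = e) (FFi : F * Fi = 1) (FiF : Fi * F = 1).
Hypotheses (EEi : E * Ei = 1) (EiE : Ei * E = 1) (HHi : H * Hi = 1) (HiH : Hi * H = 1).
Hypotheses (eF : e * F = e * F * e) (eFi : e * Fi = e * Fi * e).
Hypotheses (Ee : E * e = e * E * e) (Eie : Ei * e = e * Ei * e).
Hypotheses (eH : GRing.comm e H) (eHi : GRing.comm e Hi).
Local Notation Y := (Ei * Hi * e * Fi).

Lemma gauss_left : e * Y = Y.
Proof. by rewrite -(mulrA Ei) -eHi !mulrA -Eie. Qed.

Lemma gauss_right : Y * e = Y.
Proof. by rewrite -!mulrA (mulrA e) -eFi. Qed.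

Lemma gauss_mul : e * (F * H * E) * e * Y = e.
Proof.
rewrite -mulrA gauss_left !mulrA -(mulrA _ E Ei) EEi mulr1 -(mulrA _ H Hi) HHi.
by rewrite mulr1 -eF -mulrA FFi mulr1.
Qed.

Lemma gauss_mul_rev : Y * (e * (F * H * E) * e) = e.
Proof.
rewrite !mulrA gauss_right -(mulrA _ Fi F) FiF mulr1.
rewrite -(mulrA _ e H) eH !mulrA -(mulrA _ Hi H) HiH mulr1.
by rewrite -!mulrA (mulrA e E) -Ee mulrA EiE mul1r.
Qed.

(** For the last block q of the leading corner e, the unitriangular factors contribute only q. This
    is the quasideterminant description of the diagonal blocks. *)
Lemma gauss_diag (q : T) : q * e = q -> e * q = q -> GRing.comm q Hi ->
  q * Ei * e = q -> e * Fi * q = q -> q * q = q -> q * Y * q = Hi * q.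
Proof.
move=> qe eq qH qEi Fiq qq.
transitivity (q * Ei * e * Hi * (e * Fi * q)).
  by rewrite -(mulrA _ e Hi) eHi !mulrA -(mulrA _ e e) ee.
by rewrite qEi Fiq qH -mulrA qq.
Qed.

End GaussCorner.

Lemma corner_corner (T : pzRingType) (p e t : T) :
  p * e = p -> e * p = p -> p * (e * t * e) * p = p * t * p.
Proof. by move=> pe ep; rewrite !mulrA pe -!mulrA ep. Qed.

Section CornerDiag.
Variables (T : pzRingType) (q H Hi t : T).
Hypotheses (qq : q * q = q) (qH : GRing.comm q H) (qHi : GRing.comm q Hi).
Lemma corner_mulE : H * q * (Hi * q) = H * Hi * q.
Proof. by rewrite -(mulrA H) (mulrA q) qHi -mulrA qq mulrA. Qed.
Lemma corner_mul : H * Hi = 1 -> H * q * (Hi * q) = q.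
Proof. by move=> E; rewrite corner_mulE E mul1r. Qed.
Lemma corner_absorbl : q * (H * q) = H * q.
Proof. by rewrite mulrA qH -mulrA qq. Qed.
Lemma corner_absorbr : H * q * q = H * q.
Proof. by rewrite -mulrA qq. Qed.
Lemma corner_absorbl2 : q * (q * t * q) = q * t * q.
Proof. by rewrite !mulrA qq. Qed.
Lemma corner_absorbr2 : q * t * q * q = q * t * q.
Proof. by rewrite -!mulrA qq. Qed.
End CornerDiag.

Section GaussChain.
Variables (K : fieldType) (n : nat) (A : superAlgType K).
Hypothesis K2 : (2%:R : K) != 0.
Local Notation pi S := (proj S : QEnd n (fps A)).
Local Notation pim m := (pi (below n m)).
Variables (T : QEnd n (fps A)) (F E : 'M[End11 (fps A)]_n).
Variables (H Hinv : 'I_n -> End11 (fps A)).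
Hypotheses (T_even : even T) (T_rtt : rtt T).
Hypotheses (F_lower : lower_unitri F) (E_upper : upper_unitri E).
Hypothesis TE : T = flatten_mx (F *m diag_mx (\row_a H a) *m E).
Hypothesis HinvP : forall a, H a * Hinv a = 1 /\ Hinv a * H a = 1.

Local Notation Fq := (flatten_mx F).
Local Notation Eq := (flatten_mx E).
Local Notation Hq := (flatten_mx (diag_mx (\row_a H a))).
Local Notation Hiq := (flatten_mx (diag_mx (\row_a Hinv a))).

Let TFHE : T = Fq * Hq * Eq. Proof. by rewrite TE !flatten_mxM. Qed.

Lemma diag1_flat (G : 'I_n -> End11 (fps A)) :
  (forall a, G a = 1) -> flatten_mx (diag_mx (\row_a G a)) = 1.
Proof.
move=> G1; rewrite -(flatten_mx1 n (fps A)); congr flatten_mx.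
by apply/matrixP => a b; rewrite !mxE G1.
Qed.

Let HHi : Hq * Hiq = 1.
Proof. by rewrite flatten_diag_mul diag1_flat // => a; case: (HinvP a). Qed.
Let HiH : Hiq * Hq = 1.
Proof. by rewrite flatten_diag_mul diag1_flat // => a; case: (HinvP a). Qed.

Let xF0 (i j : qidx n) : (i.2 <= j.2)%N -> (Fq - 1) (i, j) = 0.
Proof.
move=> ij; rewrite smxDE smxNE flatten_mxE F_lower // smx1E.
case: i j ij => [b a] [b' a'] /= _; rewrite xpair_eqE.
by case: (a == a'); rewrite ?smx1E ?smx0E ?andbT ?andbF subrr.
Qed.

Let xE0 (i j : qidx n) : (j.2 <= i.2)%N -> (Eq - 1) (i, j) = 0.
Proof.
move=> ij; rewrite smxDE smxNE flatten_mxE E_upper // smx1E.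
case: i j ij => [b a] [b' a'] /= _; rewrite xpair_eqE.
by case: (a == a'); rewrite ?smx1E ?smx0E ?andbT ?andbF subrr.
Qed.

Let pp m : pim m * pim m = pim m. Proof. by rewrite proj_mul setIid. Qed.

Lemma lower_inverse : exists Fi, [/\ Fq * Fi = 1, Fi * Fq = 1 &
  forall m, pim m * Fi = pim m * Fi * pim m].
Proof.
have nil := strictly_lower_nilpotent (strictly_lower_corner xF0).
have [Fi []] := unipotent_inverse nil; rewrite addrC subrK => FFi FiF _ HF.
exists Fi; split=> // m; apply: HF => //; apply: lower_corner => i j ij.
by apply: xF0; apply: ltnW.
Qed.

Lemma upper_inverse : exists Ei, [/\ Eq * Ei = 1, Ei * Eq = 1 &
  forall m, Ei * pim m = pim m * Ei * pim m].
Proof.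
have nil := strictly_upper_nilpotent (strictly_upper_corner xE0).
have [Ei []] := unipotent_inverse nil; rewrite addrC subrK => EEi EiE HE _.
exists Ei; split=> // m; apply: HE => //; apply: upper_corner => i j ij.
by apply: xE0; apply: ltnW.
Qed.

Section Inverses.
Variables Fi Ei : QEnd n (fps A).
Hypotheses (FFi : Fq * Fi = 1) (FiF : Fi * Fq = 1).
Hypotheses (EEi : Eq * Ei = 1) (EiE : Ei * Eq = 1).
Hypothesis pFi : forall m, pim m * Fi = pim m * Fi * pim m.
Hypothesis Eip : forall m, Ei * pim m = pim m * Ei * pim m.

Let pF m : pim m * Fq = pim m * Fq * pim m.
Proof.
apply: lower_corner => i j ij; rewrite flatten_mxE (F_lower (ltnW ij)).
case: eqP => [ij2|_]; last exact: smx0E.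
by rewrite ij2 ltnn in ij.
Qed.

Let Ep m : Eq * pim m = pim m * Eq * pim m.
Proof.
apply: upper_corner => i j ij; rewrite flatten_mxE (E_upper (ltnW ij)).
case: eqP => [ij2|_]; last exact: smx0E.
by rewrite ij2 ltnn in ij.
Qed.

Definition minor m := pim m * T * pim m.
(** Truncating in the middle of E^-1 H^-1 F^-1 gives the inverse of the leading corner of T, since
    F^-1 is lower and E^-1 upper triangular; it is in general not the corner of T^-1. *)
Definition minor_inv m := Ei * Hiq * pim m * Fi.

Lemma minor_pair m : corner_pair (below n m) (minor m) (minor_inv m).
Proof.
have pH := proj_diagC (below n m) H; have pHi := proj_diagC (below n m) Hinv.
apply: rtt_pair.
- by rewrite /minor TFHE (gauss_mul FFi EEi HHi (pF m) (Eip m) pHi).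
- by rewrite /minor TFHE (gauss_mul_rev FiF EiE HiH (pFi m) (Ep m) pH).
- by rewrite /minor !mulrA pp.
- by rewrite /minor -!mulrA pp.
- exact: (gauss_left _ (Eip m) pHi).
- exact: (gauss_right _ _ (pFi m)).
- by apply: evenM; [apply: evenM; first exact: proj_even|exact: proj_even].
- exact: rtt_corner.
Qed.

Section Index.
Variable a : 'I_n.
Local Notation q := (pi [set a]).
Local Notation e := (pim a.+1).

Lemma below_split : below n a.+1 = below n a :|: [set a].
Proof. by apply/setP => b; rewrite !inE ltnS leq_eqVlt orbC. Qed.

Lemma below_disjoint : below n a :&: [set a] = set0.
Proof.
apply/setP => b; rewrite !inE; apply/negP => /andP[+ /eqP ba].
by rewrite ba ltnn.
Qed.

Let qe : q * e = q.
Proof. by rewrite proj_mul below_split; congr proj; apply/setIidPl/subsetUr. Qed.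
Let eq : e * q = q.
Proof. by rewrite proj_mul below_split; congr proj; apply/setIidPr/subsetUr. Qed.
Let qq : q * q = q. Proof. by rewrite proj_mul setIid. Qed.
Let qp : q * pim a = 0. Proof. by rewrite proj_mul setIC below_disjoint proj0. Qed.
Let pq : pim a * q = 0. Proof. by rewrite proj_mul below_disjoint proj0. Qed.

Let qEi : q * Ei * e = q.
Proof.
have xe := strictly_upper_corner xE0 a.
(* Within the columns of the leading corner, row a of [(Eq - 1) * Ei] is 0 because [Eq - 1] is
   strictly upper triangular. *)
have EiE1 : Ei = 1 - (Eq - 1) * Ei by rewrite mulrBl EEi mul1r opprB addrC subrK.
rewrite EiE1 mulrBr mulrBl mulr1 qe -!mulrA Eip !mulrA -(mulrA q) xe.
by rewrite !mulrA qp !mul0r subr0.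
Qed.

Let Fiq : e * Fi * q = q.
Proof.
have xe := strictly_lower_corner xF0 a.
have FiF1 : Fi = 1 - Fi * (Fq - 1) by rewrite mulrBr FiF mulr1 opprB addrC subrK.
rewrite FiF1 mulrBr mulrBl mulr1 eq !mulrA pFi -!(mulrA _ e) -!mulrA !(mulrA e).
by rewrite xe -(mulrA _ _ q) pq !mulr0 subr0.
Qed.

Lemma minor_inv_corner : q * minor_inv a.+1 * q = Hiq * q.
Proof.
exact: (gauss_diag (pp _) (proj_diagC _ Hinv) qe eq (proj_diagC _ Hinv) qEi Fiq qq).
Qed.

(** H_a need not be a corner of T, but H_a^-1 is a corner of the inverse of a leading corner. That
    inverse satisfies the opposite relation, which passes to its corners, and [rtt_op_pair] recovers
    the mixed relation. *)
Lemma diag_pair : corner_pair [set a] (Hq * q) (q * minor_inv a.+1 * q).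
Proof.
have M := minor_pair a.+1.
have qH : GRing.comm q Hq := proj_diagC _ H.
have qHi : GRing.comm q Hiq := proj_diagC _ Hinv.
have rM : rtt_op (minor_inv a.+1).
  apply: (rtt_inverse (pair_XY M) (pair_YX M) (pair_pYl M) (pair_pYr M)).
  exact: rtt_corner.
apply: rtt_op_pair.
- exact: (etrans (congr1 (fun Z => Hq * q * Z) minor_inv_corner) (corner_mul qq qHi HHi)).
- exact: (etrans (congr1 (fun Z => Z * (Hq * q)) minor_inv_corner) (corner_mul qq qH HiH)).
- exact: (corner_absorbl qq qH).
- exact: (corner_absorbr _ qq).
- exact: (corner_absorbl2 _ qq).
- exact: (corner_absorbr2 _ qq).
- apply: evenM; last exact: proj_even.
  by apply: evenM; [exact: proj_even|exact: pair_evenr M].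
- exact: rtt_op_corner.
Qed.

Lemma zser_minorS :
  zser (minor a.+1) (minor_inv a.+1)
  = zser (minor a) (minor_inv a) * zser (Hq * q) (Hiq * q).
Proof.
have sub : pim a * minor a.+1 * pim a = minor a.
  have pe : pim a * e = pim a.
    by rewrite proj_mul below_split; congr proj; apply/setIidPl/subsetUl.
  have ep : e * pim a = pim a.
    by rewrite proj_mul below_split; congr proj; apply/setIidPr/subsetUl.
  exact: (corner_corner T pe ep).
have Ma : corner_pair (below n a) (pim a * minor a.+1 * pim a) (minor_inv a).
  by rewrite sub; exact: minor_pair.
have aq : (false, a).2 \in [set a] by exact: set11.
have Z := zser_step K2 below_split below_disjoint (minor_pair a.+1) Ma diag_pair aq.
apply: (etrans Z); apply: (f_equal2 *%R).
  exact: (congr1 (fun x => zser x _) sub).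
exact: (congr1 (zser _) minor_inv_corner).
Qed.

End Index.
End Inverses.
End GaussChain.

(** * The factor contributed by one diagonal block *)

Section ZserDiag.
Variables (K : fieldType) (n : nat) (A : superAlgType K).
Local Notation D := (map_smx (@fps_deriv K A)).
Implicit Types (X Y : QEnd n (fps A)) (H G : 'I_n -> End11 (fps A)).
Local Notation pi S := (proj S : QEnd n (fps A)).

Lemma map_derivM X Y : D (X * Y) = D X * Y + X * D Y.
Proof.
apply/ffunP => -[i j]; rewrite smxDE ffunE !smxME fps_deriv_sum -big_split.
by apply: eq_bigr => k _; rewrite fps_derivM fps_deriv_ksign !ffunE.
Qed.

Lemma map_deriv_proj (S : {set 'I_n}) : D (pi S) = 0.
Proof.
apply/ffunP => ij; rewrite !ffunE /= -[1]/(fps_const 1).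
by case: ifP => _; rewrite ?fps_deriv_const ?fps_deriv0.
Qed.

(** The projection pi_S is constant, so dX Y = - X dY. *)
Lemma zser_rev X Y Z (S : {set 'I_n}) : X * Y = pi S -> X * D Y = Z ->
  zser X Y = 1 - \sum_i (-1) ^+ qpar i * Z (i, i).
Proof.
move=> XY <-; rewrite /zser -sumrN; congr (_ + _); apply: eq_bigr => i _.
rewrite -mulrN; congr (_ * _).
have : (D X * Y + X * D Y) (i, i) = 0 by rewrite -map_derivM XY map_deriv_proj smx0E.
by rewrite smxDE => /eqP; rewrite addr_eq0 => /eqP.
Qed.

Lemma zser_diag H G (a : 'I_n) : (forall b, H b * G b = 1) ->
  zser (flatten_mx (diag_mx (\row_b H b)) * pi [set a])
       (flatten_mx (diag_mx (\row_b G b)) * pi [set a])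
  = 1 - str (H a * smx_deriv (G a)).
Proof.
move=> HG; set q := pi [set a]; set Hq := flatten_mx _; set Gq := flatten_mx _.
have qq : q * q = q by rewrite proj_mul setIid.
have qC (M : 'I_n -> End11 (fps A)) : GRing.comm q (flatten_mx (diag_mx (\row_b M b))).
  exact: proj_diagC.
have HG1 : Hq * Gq = 1.
  by rewrite flatten_diag_mul; apply: diag1_flat.
have DG : D (Gq * q) = flatten_mx (diag_mx (\row_b smx_deriv (G b))) * q.
  apply/ffunP => -[i j].
  have E0 : D (Gq * q) (i, j) = fps_deriv ((Gq * q) (i, j)) by apply: ffunE.
  apply: (etrans E0); apply: (etrans (congr1 (@fps_deriv K A) (Mproj [set a] Gq i j))).
  apply: (etrans _ (esym (Mproj [set a] (flatten_mx _) i j))).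
  case: (j.2 \in [set a]); last exact: fps_deriv0.
  rewrite !flatten_mxE !mxE; case: eqP => _; first by rewrite !mulr1n [RHS]ffunE.
  by rewrite !mulr0n !smx0E fps_deriv0.
have HDG : Hq * q * D (Gq * q) = flatten_mx (diag_mx (\row_b (H b * smx_deriv (G b)))) * q.
  apply: (etrans (congr1 (fun Z => Hq * q * Z) DG)).
  apply: (etrans (corner_mulE Hq qq (qC _))).
  exact: (congr1 (fun Z => Z * q) (flatten_diag_mul _ _)).
rewrite (zser_rev (corner_mul qq (qC G) HG1) HDG); congr (1 - _).
rewrite sum_qidx.
have E b : \sum_c (-1) ^+ qpar (b, c)
    * (flatten_mx (diag_mx (\row_d (H d * smx_deriv (G d)))) * q) ((b, c), (b, c))
  = (-1) ^+ b * (H a * smx_deriv (G a)) (b, b).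
  rewrite (bigD1 a) //= big1 => [|c ca]; last by rewrite Mproj inE (negPf ca) mulr0.
  by rewrite addr0 Mproj inE eqxx flatten_mxE !mxE eqxx mulr1n.
transitivity (\sum_(b : bool) (-1) ^+ b * (H a * smx_deriv (G a)) (b, b)).
  by apply: eq_bigr => b _; exact: E.
by rewrite big_bool /str /= mul1r mulN1r addrC.
Qed.

End ZserDiag.

(** * Nazarov's series as a column sum *)

Section Lambda.
Variables (K : fieldType) (n : nat) (S : superAlgType K).
Local Notation p := (@qpar n).
Implicit Types (X Y : QEnd n S) (i j k m : qidx n).

Lemma tauE X i j : tau X (i, j) = (-1) ^+ ((p j && p i) (+) p j) * X (j, i).
Proof.
rewrite /tau exchange_big.
exact: (smx_unit_sumE p (fun k l => (-1) ^+ ((p l && p k) (+) p l) * X (l, k))).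
Qed.

Lemma tau2_tens2 X : tau2 (tens2 X) = tens2 (tau X).
Proof.
apply/ffunP => -[i j]; rewrite ffunE !tens2_scal !smx_scalE; case: ifP => // _.
by apply/ffunP => -[k l]; rewrite tauE !smx0E mulr0.
Qed.

(** Compare the coefficients of E_kk (x) E_kk; for even k the signs of Lambda, of tau and of the
    Koszul rule cancel. *)
Lemma Lambda_tens X Y (s : S) k : even X -> p k = false ->
  Lambda n 1 * tens1 X * tau2 (tens2 Y) = Lambda n s -> s = \sum_j X (j, k) * Y (k, j).
Proof.
move=> eX pk E.
have LE (c : S) i j l m : Lambda n c (i, j) (l, m)
    = if (l, m) == (i, j) then (-1) ^+ (p i && p j) * c else 0.
  have -> : Lambda n c (i, j) = smx_unit p i j ((-1) ^+ (p i && p j) * c).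
    exact: (smx_unit_sumE p (fun i j => smx_unit p i j ((-1) ^+ (p i && p j) * c))).
  exact: ffunE.
have LX m : (Lambda n 1 * tens1 X) (k, k) (k, m) = (-1) ^+ p m * X (m, k).
  rewrite smxME smx_sumE (bigD1 m) //= big1 => [|j jm]; last first.
    rewrite tens1_map [map_smx _ _ _]ffunE smx_MscalE ksign_smxE LE.
    by rewrite xpair_eqE [m == j]eq_sym (negPf jm) andbF ksign0 mulr0 mul0r.
  rewrite addr0 tens1_map [map_smx _ _ _]ffunE smx_MscalE ksign_smxE LE eqxx.
  by rewrite pk /= mulr1 ksign_one addbF andbb mulr1.
have := congr1 (fun Z : QEnd n (QEnd n S) => Z (k, k) (k, k)) E.
rewrite LE eqxx pk mul1r => <-.
rewrite tau2_tens2 tens2_scal smx_MscalE.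
move: (Lambda n 1 * tens1 X) LX => W LX; rewrite smxME; apply: eq_bigr => m _.
rewrite LX tauE pk /= mul1r ksign_sign evenE // pk !addbF andbb mulrA -signr_addb.
by rewrite addbb mul1r.
Qed.

End Lambda.

(** * Assembling the product over the diagonal blocks *)

Section Main.
Variables (K : fieldType) (n : nat) (A : superAlgType K).
Hypothesis K2 : (2%:R : K) != 0.
Variables (t : qgen n -> A) (relt : queer_relations t).
Local Notation T := (Tser t).

Lemma Tser_even : even T.
Proof.
have [ht _ _] := relt; apply/ffunP => -[i j]; rewrite !ffunE /=.
apply: funext => -[|r]; rewrite /hpart /= /fps_hpart /=; last exact: (ht (i, j, r)).
by case: eqP => [->|_]; rewrite ?addbb ?hpart_one ?hpart0.
Qed.

Lemma Tser_rtt : rtt T.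
Proof. by have [_ _] := relt. Qed.

Lemma flatten_Tblocks : flatten_mx (Tblocks t) = T.
Proof.
apply/ffunP => -[[b a] [b' a']].
by rewrite flatten_mxE mxE !ffunE.
Qed.

Theorem central_series_product (n_ge1 : (1 <= n)%N) (z : fps A)
    (Tinv : QEnd n (fps A)) (F E : 'M[End11 (fps A)]_n)
    (H Hinv : 'I_n -> End11 (fps A)) :
  T * Tinv = 1 -> Tinv * T = 1 ->
  Lambda n 1 * tens1 T * tau2 (tens2 Tinv) = Lambda n z ->
  lower_unitri F -> upper_unitri E ->
  Tblocks t = F *m diag_mx (\row_a H a) *m E ->
  (forall a, H a * Hinv a = 1 /\ Hinv a * H a = 1) ->
  z = \prod_(a < n) (1 - str (H a * smx_deriv (Hinv a))).
Proof.
move=> TTi TiT zP Fl Eu G HP.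
have TE : T = flatten_mx (F *m diag_mx (\row_a H a) *m E).
  by rewrite -G flatten_Tblocks.
have [Fi [FFi FiF pFi]] := lower_inverse Fl.
have [Ei [EEi EiE Eip]] := upper_inverse Eu.
pose M m := minor T m; pose M' m := minor_inv Hinv Fi Ei m.
have pair m : corner_pair (below n m) (M m) (M' m).
  exact: (minor_pair Tser_even Tser_rtt Fl Eu TE HP FFi FiF EEi EiE pFi Eip).
(* The factors are indexed by natural numbers so that the induction on m needs no change of ordinal
   type; the default 1 is never reached for i < n. *)
pose f (i : nat) : fps A :=
  if insub i is Some a then 1 - str (H a * smx_deriv (Hinv a)) else 1.
have zM m : (m <= n)%N -> zser (M m) (M' m) = \prod_(i < m) f i.
  elim: m => [_|m IH mn].
    rewrite big_ord0 /zser big1 ?addr0 // => i _.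
    have -> : M' 0%N = 0 by rewrite /M' /minor_inv below_0 mulr0 mul0r.
    by rewrite mulr0 smx0E mulr0.
  rewrite big_ord_recr /= -IH; last exact: ltnW.
  have -> : f m = 1 - str (H (Ordinal mn) * smx_deriv (Hinv (Ordinal mn))).
    by rewrite /f insubT.
  rewrite -(zser_diag (Ordinal mn) (fun b => proj1 (HP b))).
  exact: (zser_minorS K2 Tser_even Tser_rtt Fl Eu TE HP FFi FiF EEi EiE pFi Eip (Ordinal mn)).
have Mn : M n = T by rewrite /M /minor below_n mul1r mulr1.
(* For m = n the corner is the whole of T, and its left inverse coincides with the given inverse. *)
have M'n : M' n = Tinv.
  have := pair_YX (pair n); rewrite Mn below_n => E1.
  by rewrite -[LHS]mulr1 -TTi mulrA E1 mul1r.
(* Since n >= 1 there is an even index at which the column sum can be read off. *)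
pose k : qidx n := (false, Ordinal n_ge1).
have kn : k.2 \in below n n by rewrite inE ltn_ord.
rewrite (Lambda_tens Tser_even (erefl : qpar k = false) zP).
have := column_diag K2 (pair n) kn kn; rewrite eqxx Mn M'n => ->; last by [].
have := zM n (leqnn n); rewrite Mn M'n => ->.
by apply: eq_bigr => a _; rewrite /f valK.
Qed.

End Main.

Local Open Scope complex_scope.

Theorem theorem8p6 (R : realType) (n : nat) (n_ge1 : (1 <= n)%N)
    (z : fps (yangian R[i] n))
    (Tinv : QEnd n (fps (yangian R[i] n)))
    (F E : 'M[End11 (fps (yangian R[i] n))]_n)
    (H Hinv : 'I_n -> End11 (fps (yangian R[i] n)))
    (TinvP : Tser (@ygen R[i] n) * Tinv = 1 /\ Tinv * Tser (@ygen R[i] n) = 1)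
    (zP : Lambda n 1 * tens1 (Tser (@ygen R[i] n)) * tau2 (tens2 Tinv)
            = Lambda n z)
    (F_lower : lower_unitri F) (E_upper : upper_unitri E)
    (Gauss : Tblocks (@ygen R[i] n) = F *m diag_mx (\row_a H a) *m E)
    (HinvP : forall a, H a * Hinv a = 1 /\ Hinv a * H a = 1) :
  z = \prod_(a < n) (1 - str (H a * smx_deriv (Hinv a))).
Proof.
have K2 : (2%:R : R[i]) != 0 by rewrite Num.Theory.pnatr_eq0.
case: TinvP => TTi TiT.
exact: (central_series_product K2 (@yangian_relations R[i] n) n_ge1 TTi TiT zP
  F_lower E_upper Gauss HinvP).
Qed.
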